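(* Let $n\ge 2$ and $\tilde C>1$. Any bijective (1-1 and onto) transform $T:Cvx_0(\mathbb{R}^n)\to Cvx_0(\mathbb{R}^n)$ such that both $T$ and $T^{-1}$ are $\tilde C$-almost order preserving satisfies one of the following conditions: either (a) for all $f\in Cvx_0(\mathbb{R}^n)$: $\; c\, f\circ B\le Tf\le C\, f\circ B$, or (b) for all $f\in Cvx_0(\mathbb{R}^n)$: $\; c\,(\mathcal{J}f)\circ B\le Tf\le C\,(\mathcal{J}f)\circ B$, where $B\in GL(n)$ and $c,C$ are positive constants depending only on $\tilde C$.
   Context: $Cvx_0(\mathbb{R}^n)$ is the class of geometric convex functions: lower semicontinuous convex $f:\mathbb{R}^n\to[0,+\infty]$ with $f(0)=0$. Inequalities between functions are pointwise. For $\tilde C>1$ and $\tilde c=\tilde C^{-1}$, a bijection $T$ of $Cvx_0(\mathbb{R}^n)$ is $\tilde C$-almost order preserving if for all $f,g$ in the class: (i) $f\le g$ implies $Tf\le\tilde C\,Tg$; (ii) $f\le\tilde c\,g$ implies $Tf\le Tg$. The Legendre transform is $(\mathcal{L}f)(x)=\sup_{y}(\langle x,y\rangle-f(y))$. The geometric transform $\mathcal{A}:Cvx_0(\mathbb{R}^n)\to Cvx_0(\mathbb{R}^n)$ is $(\mathcal{A}f)(x)=\sup_{\{y:\,f(y)>0\}}\frac{\langle x,y\rangle-1}{f(y)}$ if $x\in\{y:f(y)=0\}^{\circ}$, and $(\mathcal{A}f)(x)=+\infty$ otherwise; here $K^\circ=\{x:\langle x,y\rangle\le1\ \forall y\in K\}$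 and $\sup\emptyset=0$. The Gauge transform is $\mathcal{J}f=\mathcal{A}\mathcal{L}f=\mathcal{L}\mathcal{A}f$.
   Formalization: The bounds hold with cλ and Cλ in place of c and C, where λ > 0 may depend on T while c, C depend only on C̃; without this factor the claim fails for Tf = λf, which is C̃-almost order preserving for every λ > 0. *)

(* Defs.v *)
From HB Require Import structures.
From mathcomp Require Import all_boot all_order all_algebra.
From mathcomp Require Import all_classical all_reals all_analysis.

Set Implicit Arguments.
Unset Strict Implicit.
Unset Printing Implicit Defensive.

Import Order.TTheory GRing.Theory Num.Theory.
Import numFieldNormedType.Exports.

Local Open Scope classical_set_scope.
Local Open Scope ring_scope.
Local Open Scope ereal_scope.

(* R^n is 'rV[R]_n, so a linear map acts on the right: x |-> x *m B. *)

Definition dotp (R : realType) (n : nat) (x y : 'rV[R]_n) : R :=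
  (\sum_(i < n) x 0 i * y 0 i)%R.

Definition le_pointwise (R : realType) (X : Type) (f g : X -> \bar R) : Prop :=
  forall x, f x <= g x.

(* The library's [convex_function] only covers finite-valued functions.  As
   [0 * +oo = 0] in \bar R, the cases t = 0 and t = 1 are harmless. *)
Definition econvex (R : realType) (n : nat) (f : 'rV[R]_n -> \bar R) : Prop :=
  forall (x y : 'rV[R]_n) (t : R), (0 <= t <= 1)%R ->
    f (t *: x + (1 - t) *: y)%R <= t%:E * f x + (1 - t)%:E * f y.

Definition Cvx0 (R : realType) (n : nat) : set ('rV[R]_n -> \bar R) :=
  [set f | [/\ forall x, 0 <= f x, f 0%R = 0, econvex f &
               lower_semicontinuous f]].
Arguments Cvx0 : clear implicits.

(* Ct^-1 plays the role of the constant c with a tilde. *)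
Definition almost_order_preserving (R : realType) (n : nat) (Ct : R)
    (T : Cvx0 R n -> Cvx0 R n) : Prop :=
  (forall f g : Cvx0 R n, le_pointwise (val f) (val g) ->
     le_pointwise (val (T f)) (fun x => Ct%:E * val (T g) x)) /\
  (forall f g : Cvx0 R n,
     le_pointwise (val f) (fun x => (Ct^-1)%:E * val g x) ->
     le_pointwise (val (T f)) (val (T g))).

Definition legendre (R : realType) (n : nat) (f : 'rV[R]_n -> \bar R) :
    'rV[R]_n -> \bar R :=
  fun x => ereal_sup [set (dotp x y)%:E - f y | y in setT].

Definition polar (R : realType) (n : nat) (K : set 'rV[R]_n) : set 'rV[R]_n :=
  [set x | forall y, K y -> (dotp x y <= 1)%R].

(* [ereal_sup set0] is -oo, whereas the geometric transform uses sup of the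
   empty set = 0. *)
Definition sup0 (R : realType) (A : set (\bar R)) : \bar R :=
  if A == set0 then 0 else ereal_sup A.

(* In \bar R, a quotient of a real number by +oo is 0. *)
Definition geometric_transform (R : realType) (n : nat)
    (f : 'rV[R]_n -> \bar R) : 'rV[R]_n -> \bar R :=
  fun x => if x \in polar [set y | f y = 0]
           then sup0 [set (dotp x y - 1)%:E / f y | y in [set y | 0 < f y]]
           else +oo.

Definition gauge_transform (R : realType) (n : nat)
    (f : 'rV[R]_n -> \bar R) : 'rV[R]_n -> \bar R :=
  geometric_transform (legendre f).

(* Main.v *)
(** Write C for [Ct]. Since C f = f when f takes only the values 0 and +oo, T preserves
    and reflects the order exactly as soon as one of the four functions involved is such
    an indicator. The indicator of a segment [0, x] is irreducible for suprema and infima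
    among the functions carried by its ray, hence so is its image, which must be the
    indicator of a segment [0, F x] or the linear function t F x |-> t on a ray. For n >= 2
    the same alternative holds for all x, and F maps triangles with vertex 0 onto
    triangles, so that F is linear by the argument of the fundamental theorem of affine
    geometry.

    It remains to test T on the functions [tri x c] (t x |-> t c for 0 <= t <= 1, and +oo
    elsewhere), since f x <= c means f <= tri x c. In the first case the image of [tri x c]
    is comparable to [tri (F x) (g x c)], and testing T and its inverse on functions which
    are linear on a triangle shows that g x c / c is constant up to the factor C^11. In the
    second case the images of the indicators and of the linear functions on the rays are
    known exactly and determine the image of [tri x c] up to C. The gauge transform is
    described by Jf(x) <= s <-> f(x / s) <= 1 / s for s > 0, which rests on the
    Fenchel-Moreau theorem. *)

Require Import Defs.
From HB Require Import structures.
From mathcomp Require Import all_boot all_order all_algebra.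
From mathcomp Require Import all_classical all_reals all_analysis.
From mathcomp Require Import ring lra.

Set Implicit Arguments.
Unset Strict Implicit.
Unset Printing Implicit Defensive.

Import Order.TTheory GRing.Theory Num.Theory.
Import numFieldNormedType.Exports.

Local Open Scope classical_set_scope.
Local Open Scope ring_scope.

(** * Functions of Cvx0 given by their epigraphs *)

(** [T] respects maxima and infima only up to constants, so structure is read off from relations
    that survive without loss. Vanishing at a point is one: f(x) = 0 iff f <= [seg x], and [seg x]
    is an indicator. Being finite at a common nonzero point is another: it says that the maximum is
    not the indicator of the origin, and constant factors do not affect this. The first relation
    carries convex combinations across [T] through the zero sets of test functions; the second makes
    rays go to rays.

    Finite positive values are only known up to powers of C, and chaining comparisons would let the
    power grow. It stays bounded because any two of these values are compared through a single third
    point, linearly independent of both base points. *)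

Section DotProduct.
Variables (R : realType) (n : nat).
Implicit Types (x y z w : 'rV[R]_n) (a b r s t : R).

Lemma dotpC x y : dotp x y = dotp y x.
Proof. by apply: eq_bigr => i _; rewrite mulrC. Qed.

Lemma dotpDr x y z : dotp x (y + z) = dotp x y + dotp x z.
Proof. by rewrite -big_split; apply: eq_bigr => i _; rewrite mxE mulrDr. Qed.

Lemma dotpZr a x y : dotp x (a *: y) = a * dotp x y.
Proof. by rewrite mulr_sumr; apply: eq_bigr => i _; rewrite mxE mulrCA. Qed.

Lemma dotpDl x y z : dotp (x + y) z = dotp x z + dotp y z.
Proof. by rewrite dotpC dotpDr !(dotpC z). Qed.

Lemma dotpZl a x y : dotp (a *: x) y = a * dotp x y.
Proof. by rewrite dotpC dotpZr dotpC. Qed.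

Lemma dotpNr x y : dotp x (- y) = - dotp x y.
Proof. by rewrite -scaleN1r dotpZr mulN1r. Qed.

Lemma dotpNl x y : dotp (- x) y = - dotp x y.
Proof. by rewrite dotpC dotpNr dotpC. Qed.

Lemma dotp0r x : dotp x 0 = 0.
Proof. by rewrite -(scale0r x) dotpZr mul0r. Qed.

Lemma dotp0l x : dotp 0 x = 0.
Proof. by rewrite dotpC dotp0r. Qed.

Lemma dotp_ge0 x : 0 <= dotp x x.
Proof. by apply: sumr_ge0 => i _; rewrite -expr2 sqr_ge0. Qed.

Lemma dotp_eq0 x : (dotp x x == 0) = (x == 0).
Proof.
apply/eqP/eqP => [h|->]; last exact: dotp0l.
apply/rowP => i; rewrite mxE; apply/eqP; rewrite -sqrf_eq0 expr2.
by move/eqP: h; rewrite psumr_eq0 => [/allP/(_ i)|j _];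
  [apply; rewrite mem_index_enum | rewrite -expr2 sqr_ge0].
Qed.

Lemma dotp_gt0 x : (0 < dotp x x) = (x != 0).
Proof. by rewrite lt_def dotp_ge0 dotp_eq0 andbT. Qed.

Lemma sqr_coord_le_dotp x i : x 0 i ^+ 2 <= dotp x x.
Proof.
rewrite /dotp (bigD1 i) //= -expr2 lerDl.
by apply: sumr_ge0 => j _; rewrite -expr2 sqr_ge0.
Qed.

Lemma dotp_continuous w : continuous (dotp w).
Proof.
have E : dotp w = (fun y => \sum_(i <- enum 'I_n) w 0 i * y 0 i).
  by apply/funext => y; rewrite /dotp big_enum.
rewrite E; elim: (enum _) => [|i l ih] x.
  have -> : (fun y : 'rV[R]_n => \sum_(i <- [::]) w 0 i * y 0 i) = cst 0.
    by apply/funext => y; rewrite big_nil.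
  exact: cst_continuous.
have -> : (fun y : 'rV[R]_n => \sum_(i <- i :: l) w 0 i * y 0 i) =
    (fun y => w 0 i * y 0 i + \sum_(i <- l) w 0 i * y 0 i).
  by apply/funext => y; rewrite big_cons.
have h : continuous_at x (fun y : 'rV[R]_n => w 0 i * y 0 i).
  apply: (@continuous_comp _ _ _ (fun y : 'rV[R]_n => y 0 i) ( *%R (w 0 i))).
    exact: coord_continuous.
  exact: mulrl_continuous.
exact: (@cvgD _ _ _ (nbhs x) _ _ _ _ _ h (ih x)).
Qed.

End DotProduct.

Section Epigraph.
Variables (R : realType) (n : nat).
Implicit Types (f g h k : Cvx0 R n) (x y z w : 'rV[R]_n) (a b r s t : R).

(* Membership in the epigraph: every extended real inequality below is expressed
   through the real numbers r with f x <= r. *)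
Definition epi f x r : Prop := (val f x <= r%:E)%E.

Definition cle f g : Prop := le_pointwise (val f) (val g).

Lemma cvx_ge0 f x : (0 <= val f x)%E.
Proof. by have /set_mem[] := valP f. Qed.

Lemma epi_ge0 f x r : epi f x r -> 0 <= r.
Proof. by move=> /(le_trans (cvx_ge0 f x)); rewrite lee_fin. Qed.

Lemma epi0 f r : 0 <= r -> epi f 0 r.
Proof. by have /set_mem[_ e _ _] := valP f; rewrite /epi e lee_fin. Qed.

Lemma epi_mono f x r s : r <= s -> epi f x r -> epi f x s.
Proof. by move=> rs /le_trans; apply; rewrite lee_fin. Qed.

Lemma epi_conv f x y r s t : 0 <= t <= 1 -> epi f x r -> epi f y s ->
  epi f (t *: x + (1 - t) *: y) (t * r + (1 - t) * s).
Proof.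
move=> t01 fx fy; have /set_mem[_ _ cf _] := valP f.
apply: (le_trans (cf x y t t01)); case/andP: t01 => t0 t1.
have -> : ((t * r + (1 - t) * s)%:E = t%:E * r%:E + (1 - t)%:E * s%:E)%E by [].
by apply: leeD; apply: lee_wpmul2l => //; rewrite lee_fin // subr_ge0.
Qed.

Lemma epi_scale f x r t : 0 <= t <= 1 -> epi f x r -> epi f (t *: x) (t * r).
Proof.
move=> t01 fx; have := epi_conv t01 fx (epi0 f (lexx 0)).
by rewrite scaler0 addr0 mulr0 addr0.
Qed.

Lemma epi_comb f x y r s a b : 0 <= a -> 0 <= b -> a + b <= 1 ->
  epi f x r -> epi f y s -> epi f (a *: x + b *: y) (a * r + b * s).
Proof.
move=> a0 b0 ab fx fy; have [b1|b1] := eqVneq (1 - a) 0.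
  have -> : b = 0 by lra.
  have -> : a = 1 by lra.
  by rewrite !scale0r !addr0 !mul0r !addr0 !scale1r mul1r.
have a1 : 0 < 1 - a by rewrite lt_def b1 /=; lra.
have fy' : epi f ((b / (1 - a)) *: y) ((b / (1 - a)) * s).
  apply: epi_scale => //; rewrite divr_ge0 ?(ltW a1) //= ler_pdivrMr //; lra.
have a01 : 0 <= a <= 1 by lra.
have := epi_conv a01 fx fy'.
by rewrite scalerA !mulrA (mulrC (1 - a) b) mulfK.
Qed.

Lemma epi_lim f x r : (forall s, r < s -> epi f x s) -> epi f x r.
Proof.
move=> h; rewrite /epi leNgt; apply/negP => lt.
case E : (val f x) lt => [v||] //=; rewrite ?lte_fin.
- move=> rv; have /andP[rm mv] : r < (r + v) / 2 < v by lra.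
  by have := h _ rm; rewrite /epi E lee_fin leNgt mv.
- by move=> _; have := h (r + 1); rewrite /epi E ltrDl ltr01 => /(_ isT).
Qed.

Lemma epi_closed f x r : ~ epi f x r -> \forall y \near x, ~ epi f y r.
Proof.
move=> /negP; rewrite /epi -ltNge => lt; have /set_mem[_ _ _ lf] := valP f.
have [V Vx hV] := lf x r lt; apply: filterS Vx => y /hV.
by rewrite ltNge => /negP.
Qed.

Lemma cleP f g : cle f g <-> (forall x r, epi g x r -> epi f x r).
Proof.
split=> [fg x r|h x]; first by move=> /(le_trans (fg x)).
case E : (val g x) => [v||]; rewrite ?leey //.
- by apply: h; rewrite /epi E.
- by have := cvx_ge0 g x; rewrite E.
Qed.

Lemma cle_refl f : cle f f.
Proof. by move=> x. Qed.

Lemma cle_trans g f h : cle f g -> cle g h -> cle f h.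
Proof. by move=> fg gh x; exact: le_trans (fg x) (gh x). Qed.

Lemma cle_anti f g : cle f g -> cle g f -> f = g.
Proof.
move=> fg gf; apply: val_inj; apply/funext => x.
by apply/eqP; rewrite eq_le fg gf.
Qed.

Lemma cvx_ext f g : (forall x r, epi f x r <-> epi g x r) -> f = g.
Proof. by move=> h; apply: cle_anti; apply/cleP => x r /h. Qed.

(** New functions are built from their epigraphs. [epi_ok_lim] closes the vertical sections, so that
    the infimum over a nonempty one is attained and [E] is recovered exactly from [infE E];
    [epi_ok_closed] is lower semicontinuity. *)
Record epi_ok (E : 'rV[R]_n -> R -> Prop) : Prop := EpiOk {
  epi_ok_ge0 : forall x r, E x r -> 0 <= r;
  epi_ok0 : E 0 0;
  epi_ok_mono : forall x r s, r <= s -> E x r -> E x s;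
  epi_ok_conv : forall x y r s t, 0 <= t <= 1 -> E x r -> E y s ->
    E (t *: x + (1 - t) *: y) (t * r + (1 - t) * s);
  epi_ok_lim : forall x r, (forall s, r < s -> E x s) -> E x r;
  epi_ok_closed : forall x r, ~ E x r -> \forall y \near x, ~ E y r }.

Definition infE (E : 'rV[R]_n -> R -> Prop) (x : 'rV[R]_n) : \bar R :=
  ereal_inf [set r%:E | r in E x].

Lemma infEP E x r : epi_ok E -> (infE E x <= r%:E)%E <-> E x r.
Proof.
move=> ok; split=> [le_r|Ex]; last by apply: ereal_inf_lbound; exists r.
apply: (epi_ok_lim ok) => s rs.
have : (infE E x < s%:E)%E by apply: le_lt_trans le_r _; rewrite lte_fin.
move=> /ereal_inf_lt[_ [r' Er' <-]]; rewrite lte_fin => /ltW r's.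
exact: (epi_ok_mono ok) r's Er'.
Qed.

Lemma infE_ge0 E x : epi_ok E -> (0 <= infE E x)%E.
Proof.
move=> ok; apply: le_ereal_inf_tmp => _ [r Er <-]; rewrite lee_fin.
exact: (epi_ok_ge0 ok) Er.
Qed.

Lemma infE_cvx E : epi_ok E -> Cvx0 R n (infE E).
Proof.
move=> ok; split.
- by move=> x; exact: infE_ge0.
- apply/eqP; rewrite eq_le infE_ge0 // andbT; apply/infEP => //.
  exact: epi_ok0.
- move=> x y t /[dup] t01 /andP[t0 t1].
  (* The endpoints are split off because 0 * +oo = 0: the infinite cases below need both weights
     positive. *)
  have [->|tn0] := eqVneq t 0.
    by rewrite scale0r add0r subr0 scale1r mul0e add0e mul1e.
  have [->|tn1] := eqVneq t 1.
    by rewrite subrr scale0r addr0 scale1r mul0e adde0 mul1e.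
  have tp : 0 < t by rewrite lt_def tn0.
  have tq : 0 < 1 - t by rewrite subr_gt0 lt_def eq_sym tn1.
  have := infE_ge0 x ok; have := infE_ge0 y ok.
  case Ex : (infE E x) => [u||] //; case Ey : (infE E y) => [v||] // _ _.
  + rewrite -!EFinM -EFinD; apply/infEP => //.
    apply: (epi_ok_conv ok) => //; first by apply/(infEP _ _ ok); rewrite Ex.
    by apply/(infEP _ _ ok); rewrite Ey.
  + by rewrite gt0_muley ?lte_fin // addey ?leey // -EFinM.
  + by rewrite [X in (X + _)%E]gt0_muley ?lte_fin // addye ?leey // -EFinM.
  + by rewrite !gt0_muley ?lte_fin // leey.
- move=> x a lt; have : ~ E x a by move/(infEP _ _ ok); rewrite leNgt lt.
  move=> /(epi_ok_closed ok) nE.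
  exists [set y | ~ E y a] => // y nEy; rewrite ltNge; apply/negP.
  by move/(infEP _ _ ok).
Qed.

Definition epiC E (ok : epi_ok E) : Cvx0 R n :=
  exist _ (infE E) (mem_set (infE_cvx ok)).

Lemma epiCP E (ok : epi_ok E) x r : epi (epiC ok) x r <-> E x r.
Proof. exact: infEP. Qed.

Lemma cvx_max_ok f g : epi_ok (fun x r => epi f x r /\ epi g x r).
Proof.
split.
- by move=> x r [/epi_ge0].
- by split; exact: epi0.
- by move=> x r s rs [fx gx]; split; exact: epi_mono rs _.
- by move=> x y r s t t01 [? ?] [? ?]; split; exact: epi_conv.
- by move=> x r h; split; apply: epi_lim => s /h[].
- move=> x r /not_andP[/epi_closed|/epi_closed]; apply: filterS => y ny [] //.
Qed.

Definition cvx_max f g := epiC (cvx_max_ok f g).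

Lemma cvx_maxP f g x r : epi (cvx_max f g) x r <-> epi f x r /\ epi g x r.
Proof. exact: epiCP. Qed.

Lemma cle_maxl f g : cle f (cvx_max f g).
Proof. by apply/cleP => x r /cvx_maxP[]. Qed.

Lemma cle_maxr f g : cle g (cvx_max f g).
Proof. by apply/cleP => x r /cvx_maxP[]. Qed.

Lemma cvx_scale_ok c f : 0 < c -> epi_ok (fun x r => epi f x (r / c)).
Proof.
move=> c0; split.
- by move=> x r /epi_ge0; rewrite pmulr_lge0 ?invr_gt0.
- by rewrite mul0r; exact: epi0.
- by move=> x r s rs; apply: epi_mono; rewrite ler_pM2r ?invr_gt0.
- move=> x y r s t t01 fx fy.
  by rewrite mulrDl -!mulrA; exact: epi_conv.
- move=> x r h; apply: epi_lim => s; rewrite ltr_pdivrMr // => /h.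
  by rewrite mulfK ?gt_eqF.
- by move=> x r /epi_closed.
Qed.

Definition cvx_scale c (c0 : 0 < c) f := epiC (cvx_scale_ok f c0).

Lemma cvx_scaleP c (c0 : 0 < c) f x r : epi (cvx_scale c0 f) x r <-> epi f x (r / c).
Proof. exact: epiCP. Qed.

Definition halfspaces (A : set ('rV[R]_n * R * R)) (x : 'rV[R]_n) (r : R) :=
  0 <= r /\ forall w b c, A (w, b, c) -> dotp w x <= b + c * r.

Lemma halfspaces_ok A :
  (forall w b c, A (w, b, c) -> 0 <= b /\ 0 <= c) -> epi_ok (halfspaces A).
Proof.
move=> A0; split.
- by move=> x r [].
- split=> // w b c /A0[b0 _]; rewrite dotp0r mulr0 addr0 //.
- move=> x r s rs [r0 h]; split; first exact: le_trans rs.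
  move=> w b c Aw; apply: (le_trans (h _ _ _ Aw)); rewrite lerD2l.
  by apply: ler_wpM2l => //; case: (A0 _ _ _ Aw).
- move=> x y r s t /andP[t0 t1] [r0 hx] [s0 hy].
  have t1' : 0 <= 1 - t by rewrite subr_ge0.
  split; first by rewrite addr_ge0 // mulr_ge0.
  move=> w b c Aw; rewrite dotpDr !dotpZr.
  have := ler_wpM2l t0 (hx _ _ _ Aw); have := ler_wpM2l t1' (hy _ _ _ Aw).
  nra.
- move=> x r h; split.
    by apply/ler_addgt0Pr => e e0; case: (h (r + e)); rewrite ?ltrDl.
  move=> w b c Aw; have [b0 c0] := A0 _ _ _ Aw.
  apply/ler_addgt0Pr => e e0.
  (* Dividing by c + 1 covers c = 0 as well. *)
  have c1 : 0 < c + 1 by rewrite ltr_wpDl.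
  case: (h (r + e / (c + 1))); first by rewrite ltrDl divr_gt0.
  move=> _ /(_ _ _ _ Aw) /le_trans; apply.
  rewrite mulrDr addrA lerD2l mulrCA ger_pMr // ler_pdivrMr // mul1r; lra.
- move=> x r /not_andP[r0|]; first by near=> y; case.
  move=> /existsNP[w /existsNP[b /existsNP[c /not_implyP[Aw /negP]]]].
  rewrite -ltNge => lt.
  have := @dotp_continuous _ _ w x; move=> /cvgr_gt/(_ _ lt).
  apply: filterS => y /= lt' [_ /(_ _ _ _ Aw)]; rewrite leNgt.
  by move=> /negP; apply.
Unshelve. all: by end_near.
Qed.

End Epigraph.

(** * Test functions carried by rays, lines and planar cones *)

Section Constructions.
Variables (R : realType) (n : nat).
Implicit Types (f g h : Cvx0 R n) (x y z w p q u v : 'rV[R]_n).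
Implicit Types (a b c d k l r s t : R).

(** [p] and [q] read off the coordinates of [z] along [x] and [y], the equation confines [z] to
    their span, and each entry of [D] is a linear constraint on the coordinates and the height. *)
Definition spanE x y p q (D : seq (R * R * R * R)) z r :=
  [/\ 0 <= r, z = dotp p z *: x + dotp q z *: y &
  forall a b c d, (a, b, c, d) \in D ->
    a * dotp p z + b * dotp q z <= c + d * r].

(** The equation for [z] is itself a family of linear inequalities <v, z - <p,z> x - <q,z> y> <= 0
    over all v; taking the difference itself for v forces it to vanish. *)
Lemma spanE_ok x y p q D :
  (forall a b c d, (a, b, c, d) \in D -> 0 <= c /\ 0 <= d) ->
  epi_ok (spanE x y p q D).
Proof.
move=> D0.
pose A : set ('rV[R]_n * R * R) := fun e =>
  (exists v, e = (v - dotp v x *: p - dotp v y *: q, 0, 0)) \/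
  (exists a b c d, (a, b, c, d) \in D /\ e = (a *: p + b *: q, c, d)).
have okA : epi_ok (halfspaces A).
  apply: halfspaces_ok => w b c [[v [_ -> ->]]//|].
  by move=> [a [b' [c' [d [/D0[? ?] [_ -> ->]]]]]].
suff -> : spanE x y p q D = halfspaces A by [].
apply/funext => z; apply/funext => r; apply/propext; split.
  move=> [r0 ez hD]; split=> // w b c [[v [-> -> ->]]|].
    rewrite mul0r addr0 !dotpDl !dotpNl !dotpZl {1}ez dotpDr !dotpZr; lra.
  move=> [a [b' [c' [d [/hD h [-> -> ->]]]]]].
  by rewrite dotpDl !dotpZl.
move=> [r0 h]; split=> //; last first.
  move=> a b c d abcd; rewrite -!dotpZl -dotpDl; apply: h.
  by right; exists a, b, c, d.
apply/eqP; rewrite -subr_eq0 opprD addrA.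
set v := _ - _ - _; rewrite -dotp_eq0 eq_le dotp_ge0 andbT.
have := h _ _ _ (or_introl (ex_intro _ v erefl)).
rewrite mul0r addr0 !dotpDl !dotpNl !dotpZl.
by rewrite !dotpDr !dotpNr !dotpZr; lra.
Qed.

(** For z = t x the entries say t >= 0, k t <= 1 and a t <= r: slope a, cut off at 1/k, or not at
    all for k = 0. *)
Definition ray_constr a k : seq (R * R * R * R) :=
  [:: (-1, 0, 0, 0); (k, 0, 1, 0); (a, 0, 0, 1)].

(* For x = 0 this is 0, so that [ray 0 a k] is the indicator of {0}. *)
Definition dualv x := (dotp x x)^-1 *: x.

Lemma dotp_dualv x : x != 0 -> dotp (dualv x) x = 1.
Proof. by move=> x0; rewrite dotpZl mulVf // dotp_eq0. Qed.

Lemma ray_ok x a k : epi_ok (spanE x 0 (dualv x) 0 (ray_constr a k)).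
Proof.
apply: spanE_ok => ? ? ? ?; rewrite !inE.
by move=> /or3P[]/eqP[_ _ -> ->]; rewrite ?ler01 ?lexx.
Qed.

Definition ray x a k : Cvx0 R n := epiC (ray_ok x a k).

Lemma rayP x a k y r : epi (ray x a k) y r <->
  0 <= r /\ exists t, [/\ 0 <= t, k * t <= 1, a * t <= r & y = t *: x].
Proof.
rewrite epiCP; split=> [[r0]|[r0 [t [t0 kt at_ ->]]]].
  rewrite dotp0l scaler0 addr0 => ey h; split=> //.
  exists (dotp (dualv x) y); split=> //.
  - have := h (-1) 0 0 0; rewrite !inE eqxx => /(_ isT); lra.
  - have := h k 0 1 0; rewrite !inE eqxx orbT => /(_ isT); lra.
  - have := h a 0 0 1; rewrite !inE eqxx !orbT => /(_ isT); lra.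
have [->|x0] := eqVneq x 0.
  rewrite scaler0; split; rewrite ?dotp0r ?scaler0 ?addr0 // => ? ? ? ?.
  by rewrite !inE => /or3P[]/eqP[-> -> -> ->]; lra.
split=> //; rewrite dotpZr dotp_dualv // dotp0l mulr1 ?scaler0 ?addr0 //.
move=> ? ? ? ?.
by rewrite !inE => /or3P[]/eqP[-> -> -> ->]; lra.
Qed.

Definition seg x := ray x 0 1.
Definition lin x a := ray x a 0.
Definition tri x a := ray x a 1.

Lemma segP x y r :
  epi (seg x) y r <-> 0 <= r /\ exists2 t, 0 <= t <= 1 & y = t *: x.
Proof.
rewrite rayP; split=> [[r0 [t [t0 t1 _ ->]]]|[r0 [t /andP[t0 t1] ->]]].
  by split=> //; exists t => //; rewrite t0 -[t]mul1r.
by split=> //; exists t; split=> //; rewrite ?mul1r ?mul0r.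
Qed.

Lemma linP x a y r : epi (lin x a) y r <->
  0 <= r /\ exists t, [/\ 0 <= t, a * t <= r & y = t *: x].
Proof.
rewrite rayP; split=> [[r0 [t [t0 _ h ->]]]|[r0 [t [t0 h ->]]]].
  by split=> //; exists t.
by split=> //; exists t; split=> //; rewrite mul0r ler01.
Qed.

Lemma triP x a y r : epi (tri x a) y r <->
  0 <= r /\ exists t, [/\ 0 <= t, t <= 1, a * t <= r & y = t *: x].
Proof. by rewrite rayP; setoid_rewrite mul1r. Qed.

Lemma line_ok x : epi_ok (spanE x 0 (dualv x) 0 [::]).
Proof. exact: spanE_ok. Qed.

Definition line x : Cvx0 R n := epiC (line_ok x).

Lemma lineP x y r : epi (line x) y r <-> 0 <= r /\ exists t, y = t *: x.
Proof.
rewrite epiCP; split=> [[r0 e _]|[r0 [t ->]]].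
  split=> //; exists (dotp (dualv x) y).
  by move: e; rewrite dotp0l scaler0 addr0.
split=> //; have [->|x0] := eqVneq x 0; first by rewrite !scaler0 addr0.
by rewrite dotpZr dotp_dualv // mulr1 scaler0 addr0.
Qed.

Definition indep x y := forall a b, a *: x + b *: y = 0 -> a = 0 /\ b = 0.

Lemma indepC x y : indep x y -> indep y x.
Proof. by move=> h a b; rewrite addrC => /h[]. Qed.

Lemma indep_neq0 x y : indep x y -> x != 0.
Proof.
move=> h; apply/eqP => x0; case: (h 1 0); rewrite ?x0 ?scaler0 ?scale0r ?addr0 //.
by move=> /eqP; rewrite oner_eq0.
Qed.

Lemma indep_nscale x y t : indep x y -> y <> t *: x.
Proof.
move=> h e; case: (h t (-1)); first by rewrite e scaleN1r subrr.
by move=> _ /eqP; rewrite oppr_eq0 oner_eq0.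
Qed.

Lemma indepP x y : x != 0 -> (forall t, y <> t *: x) -> indep x y.
Proof.
move=> x0 h a b e; have [b0|b0] := eqVneq b 0.
  by move: e => /eqP; rewrite b0 scale0r addr0 scaler_eq0 (negbTE x0) orbF => /eqP.
case: (h (- (b^-1 * a))); apply: (scalerI b0); rewrite scalerA mulrN mulVKf //.
by rewrite scaleNr; apply/eqP; rewrite -addr_eq0 addrC e.
Qed.

Lemma indep_mid x y : indep x y -> indep x (2^-1 *: x + 2^-1 *: y).
Proof.
move=> xy a b; rewrite scalerDr addrA !scalerA -scalerDl => /xy[ab /eqP].
rewrite mulf_eq0 invr_eq0 pnatr_eq0 orbF => /eqP b0.
by move: ab; rewrite b0 mul0r addr0.
Qed.

Lemma indep_mid2 x y : indep x y -> indep y (2^-1 *: x + 2^-1 *: y).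
Proof. by move=> xy; rewrite addrC; apply: indep_mid; exact: indepC. Qed.

Lemma biorthogonal x y : indep x y -> exists p q,
  [/\ dotp p x = 1, dotp p y = 0, dotp q x = 0 & dotp q y = 1].
Proof.
have half u v : indep u v -> exists2 p, dotp p u = 1 & dotp p v = 0.
  move=> uv; have v0 := indep_neq0 (indepC uv).
  pose p := u - (dotp u v / dotp v v) *: v.
  have vv : dotp v v != 0 by rewrite dotp_eq0.
  have pv : dotp p v = 0 by rewrite dotpDl dotpNl dotpZl divfK // subrr.
  have p0 : p != 0.
    apply/eqP => e; have := @uv 1 (- (dotp u v / dotp v v)).
    by rewrite scale1r scaleNr => /(_ e)[/eqP]; rewrite oner_eq0.
  have pu : dotp p u = dotp p p by rewrite {3}/p dotpDr dotpNr dotpZr pv mulr0 subr0.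
  exists ((dotp p p)^-1 *: p); rewrite dotpZl ?pv ?mulr0 // pu mulVf //.
  by rewrite dotp_eq0.
move=> xy; have [p px py] := half _ _ xy.
by have [q qy qx] := half _ _ (indepC xy); exists p, q.
Qed.

(** The common source of the two-dimensional test functions: the positive part of a linear form on a
    piece of the cone over x and y. (k, l) = (1, 1) cuts out the triangle with vertices 0, x, y, and
    (0, 0) keeps the whole cone. *)
Lemma planar x y a b k l : indep x y -> exists f, forall z r,
  epi f z r <-> 0 <= r /\ exists s t, [/\ 0 <= s, 0 <= t, k * s + l * t <= 1,
    a * s + b * t <= r & z = s *: x + t *: y].
Proof.
move=> xy; have [p [q [px py qx qy]]] := biorthogonal xy.
pose D : seq (R * R * R * R) :=
  [:: (-1, 0, 0, 0); (0, -1, 0, 0); (k, l, 1, 0); (a, b, 0, 1)].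
have ok : epi_ok (spanE x y p q D).
  apply: spanE_ok => ? ? ? ?; rewrite !inE.
  by move=> /or4P[]/eqP[_ _ -> ->]; rewrite ?ler01 ?lexx.
exists (epiC ok) => z r; rewrite epiCP.
split=> [[r0 ez h]|[r0 [s [t [s0 t0 kl ab ->]]]]].
  split=> //; exists (dotp p z), (dotp q z); split=> //.
  - have := h (-1) 0 0 0; rewrite !inE eqxx => /(_ isT); lra.
  - have := h 0 (-1) 0 0; rewrite !inE eqxx !orbT => /(_ isT); lra.
  - have := h k l 1 0; rewrite !inE eqxx !orbT => /(_ isT); lra.
  - have := h a b 0 1; rewrite !inE eqxx !orbT => /(_ isT); lra.
have ps : dotp p (s *: x + t *: y) = s.
  by rewrite dotpDr !dotpZr px py mulr1 mulr0 addr0.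
have qt : dotp q (s *: x + t *: y) = t.
  by rewrite dotpDr !dotpZr qx qy mulr1 mulr0 add0r.
split; rewrite ?ps ?qt // => ? ? ? ?; rewrite !inE.
by move=> /or4P[]/eqP[-> -> -> ->]; lra.
Qed.

Lemma hinge w b d : 0 <= b -> 0 < d -> exists f, forall z r,
  epi f z r <-> 0 <= r /\ dotp w z <= b + d * r.
Proof.
move=> b0 d0; pose A : set ('rV[R]_n * R * R) := [set (w, b, d)].
have ok : epi_ok (halfspaces A).
  by apply: halfspaces_ok => ? ? ? [_ -> ->]; split=> //; exact: ltW.
exists (epiC ok) => z r; rewrite epiCP.
by split=> [[r0 h]|[r0 h]]; split=> //; [exact: h | move=> ? ? ? [-> -> ->]].
Qed.

Lemma near_ray x (P : 'rV[R]_n -> Prop) : (\forall y \near x, P y) ->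
  exists2 t, 0 < t < 1 & forall s, t <= s <= 1 -> P (s *: x).
Proof.
move=> Px; have c1 : {for 1, continuous (fun s : R => s *: x)} by exact: scalel_continuous.
have : \forall s \near (1 : R), P (s *: x).
  by apply: c1; rewrite scale1r.
move=> /nbhs_ballP[e /= e0 he].
exists (1 - (Num.min e 1) / 2).
  by have : 0 < Num.min e 1 <= 1; [rewrite lt_min e0 ltr01 ge_min lexx orbT | lra].
move=> s /andP[s1 s2]; apply: he; rewrite /ball /= ger0_norm ?subr_ge0 //.
have : Num.min e 1 <= e by rewrite ge_min lexx.
have : 0 < Num.min e 1 by rewrite lt_min e0 ltr01.
lra.
Qed.

Lemma epi_near_ray f x r : ~ epi f x r ->
  exists2 t, 0 < t < 1 & forall s, t <= s <= 1 -> ~ epi f (s *: x) r.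
Proof. by move=> /epi_closed/near_ray. Qed.

Lemma epi_ray_lim f x r : (forall t, 0 < t < 1 -> epi f (t *: x) r) -> epi f x r.
Proof.
move=> h; apply: contrapT => /epi_near_ray[t t01 /(_ t)].
by rewrite lexx => h'; apply: h'; [case/andP: t01 => _ /ltW -> | exact: h].
Qed.

Lemma not_epi_gt f x r : ~ epi f x r -> exists2 s, r < s & ~ epi f x s.
Proof.
move=> h; apply: contrapT => h'; apply: h; apply: epi_lim => s rs.
by apply: contrapT => ns; apply: h'; exists s.
Qed.

Definition indicator f := forall x r, epi f x r -> epi f x 0.
Definition onray u f := forall x r, epi f x r -> exists2 t, 0 <= t & x = t *: u.
(** Equivalent to the maximum of the two functions not being [ctop], hence insensitive to constant
    factors. *)
Definition compat f g := exists x r, [/\ x != 0, epi f x r & epi g x r].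

Definition ctop := seg 0.

Lemma ctopP x r : epi ctop x r <-> 0 <= r /\ x = 0.
Proof.
rewrite segP; split=> [[r0 [t _ ->]]|[r0 ->]]; first by rewrite scaler0.
by split=> //; exists 0; rewrite ?lexx ?ler01 ?scaler0.
Qed.

Lemma cle_top f : cle f ctop.
Proof. by apply/cleP => x r /ctopP[r0 ->]; exact: epi0. Qed.

Lemma neq_ctop f : f <> ctop -> exists x r, x != 0 /\ epi f x r.
Proof.
move=> ft; apply: contrapT => h; apply: ft; apply: cle_anti; first exact: cle_top.
apply/cleP => x r fx; apply/ctopP; split; first exact: epi_ge0 fx.
by apply/eqP; apply: contrapT => /negP x0; apply: h; exists x, r.
Qed.

Lemma neq_ctop_epi f x r : x != 0 -> epi f x r -> f <> ctop.
Proof. by move=> /eqP x0 fx e; apply: x0; move: fx; rewrite e => /ctopP[]. Qed.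

Lemma cle_neq_ctop f g : cle f g -> g <> ctop -> f <> ctop.
Proof.
move=> fg gt ft; apply: gt; apply: cle_anti; first exact: cle_top.
by rewrite -ft.
Qed.

Lemma seg_indicator x : indicator (seg x).
Proof. by move=> y r /segP[r0 h]; apply/segP. Qed.

Lemma seg_onray x : onray x (seg x).
Proof. by move=> y r /segP[_ [t /andP[t0 _] ->]]; exists t. Qed.

Lemma lin_onray x a : onray x (lin x a).
Proof. by move=> y r /linP[_ [t [t0 _ ->]]]; exists t. Qed.

Lemma epi_seg x : epi (seg x) x 0.
Proof.
by apply/segP; split=> //; exists 1; rewrite ?ler01 ?lexx ?scale1r.
Qed.

Lemma epi_lin x a t : 0 <= t -> 0 <= a * t -> epi (lin x a) (t *: x) (a * t).
Proof. by move=> t0 at0; apply/linP; split=> //; exists t. Qed.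

Lemma scalerIr x a b : x != 0 -> a *: x = b *: x -> a = b.
Proof.
move=> x0 /eqP; rewrite -subr_eq0 -scalerBl scaler_eq0 (negbTE x0) orbF.
by rewrite subr_eq0 => /eqP.
Qed.

Lemma epi_segE x t r : x != 0 -> epi (seg x) (t *: x) r <-> 0 <= r /\ 0 <= t <= 1.
Proof.
move=> x0; rewrite segP; split=> [[r0 [s s01 /(scalerIr x0) ->]]|[r0 t01]] //.
by split=> //; exists t.
Qed.

Lemma epi_linE x a t r : x != 0 ->
  epi (lin x a) (t *: x) r <-> [/\ 0 <= r, 0 <= t & a * t <= r].
Proof.
move=> x0; rewrite linP; split=> [[r0 [s [s0 h /(scalerIr x0) ->]]]|[r0 t0 h]] //.
by split=> //; exists t.
Qed.

Lemma epi_triE x a t r : x != 0 ->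
  epi (tri x a) (t *: x) r <-> [/\ 0 <= r, 0 <= t, t <= 1 & a * t <= r].
Proof.
move=> x0; rewrite triP; split=> [[r0 [s [s0 s1 h /(scalerIr x0) ->]]]|[r0 t0 t1 h]] //.
by split=> //; exists t.
Qed.

Lemma cle_seg f x : cle f (seg x) <-> epi f x 0.
Proof.
split=> [/cleP/(_ _ _ (epi_seg x))//|fx].
apply/cleP => y r /segP[r0 [t t01 ->]].
by apply: epi_mono r0 _; rewrite -[0](mulr0 t); exact: epi_scale.
Qed.

Lemma cle_tri f x a : 0 <= a -> cle f (tri x a) <-> epi f x a.
Proof.
move=> a0; split=> [/cleP|fx].
  apply; apply/triP; split=> //; exists 1.
  by rewrite ler01 lexx mulr1 scale1r.
apply/cleP => y r /triP[r0 [t [t0 t1 h ->]]]; apply: epi_mono h _.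
by rewrite mulrC; apply: epi_scale => //; rewrite t0.
Qed.

Lemma cle_onray x f : onray x f -> cle (lin x 0) f.
Proof.
move=> fx; apply/cleP => y r /[dup] /epi_ge0 r0 /fx[t t0 ->].
by apply/linP; split=> //; exists t; rewrite mul0r.
Qed.

Lemma indep_compat x y f g : indep x y -> onray x f -> onray y g -> ~ compat f g.
Proof.
move=> xy fx gy [z [r [/eqP z0 /fx[s _ zs] /gy[t _ zt]]]].
case: (xy s (- t)) => [|s0 _]; first by rewrite scaleNr -zs -zt subrr.
by apply: z0; rewrite zs s0 scale0r.
Qed.

Lemma onray_epi_pos u f : onray u f -> f <> ctop ->
  exists2 t, 0 < t & exists r, epi f (t *: u) r.
Proof.
move=> fu /neq_ctop[x [r [x0 fx]]]; have [t t0 e] := fu _ _ fx.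
exists t; last by exists r; rewrite -e.
by rewrite lt_def t0 andbT; apply: contraNneq x0 => tz; rewrite e tz scale0r.
Qed.

Lemma epi_segment f u s t r : 0 <= s <= t -> epi f (t *: u) r -> epi f (s *: u) r.
Proof.
move=> /andP[s0 st] fr; have r0 := epi_ge0 fr.
have [t0|t0] := eqVneq t 0.
  by have -> : s = 0 by [apply/eqP; rewrite eq_le s0 -t0 st]; rewrite scale0r; exact: epi0.
have tp : 0 < t by rewrite lt_def t0 (le_trans s0).
have st1 : 0 <= s / t <= 1 by rewrite divr_ge0 ?(ltW tp) //= ler_pdivrMr // mul1r.
have := epi_scale st1 fr; rewrite scalerA divfK //; apply: epi_mono.
by rewrite ler_piMl //; case/andP: st1.
Qed.

Lemma compat_onray u f g : u != 0 -> onray u f -> onray u g ->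
  f <> ctop -> g <> ctop -> compat f g.
Proof.
move=> u0 fu gu ft gt.
have [s s0 [r fr]] := onray_epi_pos fu ft.
have [t t0 [r' gr]] := onray_epi_pos gu gt.
have m0 : 0 < Num.min s t by rewrite lt_min s0.
exists (Num.min s t *: u), (Num.max r r'); split.
- by rewrite scaler_eq0 negb_or gt_eqF.
- apply: (@epi_segment _ _ _ s); first by rewrite (ltW m0) ge_min lexx.
  by apply: epi_mono fr; rewrite le_max lexx.
- apply: (@epi_segment _ _ _ t); first by rewrite (ltW m0) ge_min lexx orbT.
  by apply: epi_mono gr; rewrite le_max lexx orbT.
Qed.

End Constructions.

(** * The gauge transform *)

Section GaugeTransform.
Variables (R : realType) (n : nat).
Implicit Types (f : Cvx0 R n) (x y z w : 'rV[R]_n) (a b r s t : R).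

Lemma near_sqd x (P : 'rV[R]_n -> Prop) : (\forall y \near x, P y) ->
  exists2 e, 0 < e & forall y, dotp (y - x) (y - x) < e ^+ 2 -> P y.
Proof.
move=> /nbhs_ballP[e /= e0 he]; exists e => // y ye; apply: he; split=> // i j.
have := sqr_coord_le_dotp (y - x) j.
rewrite !mxE => /le_lt_trans/(_ ye) c; rewrite ord1.
have : `|x 0 j - y 0 j| < e.
  rewrite distrC -ltr_sqr ?nnegrE ?(ltW e0) //.
  by rewrite real_normK ?num_real.
exact.
Qed.

Lemma sqd_ge x y z :
  dotp (z - x) (z - x) + 2 * dotp (z - x) (y - z) <= dotp (y - x) (y - x).
Proof.
have h (u v : 'rV[R]_n) : dotp u u + 2 * dotp u v <= dotp (u + v) (u + v).
  rewrite dotpDl !dotpDr (dotpC v u); have := dotp_ge0 v; lra.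
by rewrite (le_trans (h _ _)) // addrC subrKA.
Qed.

Lemma dotp_sqrB x y t : dotp (t *: x - y) (t *: x - y) =
  t ^+ 2 * dotp x x - 2 * t * dotp x y + dotp y y.
Proof.
by rewrite dotpDl !dotpDr !dotpNl !dotpNr !dotpZl !dotpZr (dotpC y x); ring.
Qed.

Lemma box_compact x r : compact [set v : 'rV[R]_n | forall i, `|v 0 i - x 0 i| <= r].
Proof.
have := @rV_compact R n (fun i => `[x 0 i - r, x 0 i + r]%classic).
move=> /(_ (fun _ => @segment_compact _ _ _)); congr compact.
by apply/seteqP; split=> v /= h i; have := h i; rewrite in_itv /= ler_distl.
Qed.

(* p minimises f + k/2 |. - x|^2, with minimal value m. *)
Lemma proximal_point f x k : 0 < k -> exists p m,
  epi f p (m - k / 2 * dotp (p - x) (p - x)) /\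
  forall z v, epi f z v -> m <= v + k / 2 * dotp (z - x) (z - x).
Proof.
move=> k0; pose q z := dotp (z - x) (z - x); rewrite -/(q _).
have q0 z : 0 <= q z by exact: dotp_ge0.
have k20 : 0 < k / 2 by lra.
pose A := [set r | exists z v, epi f z v /\ r = v + k / 2 * q z].
have A0 : A (0 + k / 2 * q 0) by exists 0, 0; split=> //; exact: epi0.
have lbA : has_inf A.
  split; first by exists (0 + k / 2 * q 0).
  exists 0 => _ [z [v [/epi_ge0 v0 ->]]].
  by rewrite addr_ge0 // mulr_ge0 // ltW.
pose m := inf A.
have m_le z v : epi f z v -> m <= v + k / 2 * q z.
  by move=> fz; apply: ge_inf; [exact: lbA.2 | exists z, v].
pose S (e : R) := [set z | epi f z (m + e - k / 2 * q z)].
have S0 e : 0 < e -> S e !=set0.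
  move=> e0; have [_ [z [v [fz ->]]] lt] := inf_adherent e0 lbA.
  by exists z; apply: epi_mono fz; rewrite lerBrDr ltW.
have Sle e1 e2 : e1 <= e2 -> S e1 `<=` S e2.
  by move=> e12 z; apply: epi_mono; lra.
(* As f >= 0, a minimiser up to 1 satisfies k/2 |z - x|^2 <= m + 1, which bounds its coordinates. *)
pose D := 2 / k * (m + 1).
have Sbox : S 1 `<=` [set v : 'rV[R]_n | forall i, `|v 0 i - x 0 i| <= D + 1].
  move=> z /epi_ge0 h i; have := sqr_coord_le_dotp (z - x) i; rewrite -/(q z) !mxE => c.
  have qD : q z <= D.
    have : 2 / k * (k / 2 * q z) <= 2 / k * (m + 1).
      by rewrite ler_pM2l; [lra | rewrite divr_gt0].
    by rewrite mulrA mulf_div (mulrC k) divff ?mul1r // mulf_neq0 // gt_eqF.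
  have D0 : 0 <= D by exact: le_trans qD.
  rewrite -ler_sqr ?nnegrE ?addr_ge0 // real_normK ?num_real //.
  by apply: (le_trans c); apply: (le_trans qD); rewrite sqrrD; nra.
(* The almost minimisers generate a filter on a compact box; [p] is one of its cluster points. *)
pose FF := filter_from [set e : R | 0 < e] S.
have FFf : ProperFilter FF.
  apply: filter_from_proper => //; apply: filter_from_filter; first by exists 1; exact: ltr01.
  move=> e1 e2 /= e10 e20; exists (Num.min e1 e2); first by rewrite /= lt_min e10.
  by move=> z Sz; split; apply: Sle Sz; rewrite ge_min lexx ?orbT.
have FB : FF [set v : 'rV[R]_n | forall i, `|v 0 i - x 0 i| <= D + 1].
  by exists 1 => //=; exact: ltr01.
have [p [_ clp]] := box_compact FFf FB.
exists p, m; split=> //.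
apply: contrapT => /not_epi_gt[s ms /epi_closed np].
(* Otherwise f would exceed s near [p]. The gap d is shared equally between the tolerance of an
   almost minimiser y near [p] and the error in the tangent inequality [sqd_ge]. *)
pose d := s - (m - k / 2 * q p); have d0 : 0 < d by rewrite subr_gt0.
have e0 : 0 < d / 2 by lra.
have dk0 : 0 < d / (2 * k) by rewrite divr_gt0 // mulr_gt0.
have cont : \forall y \near p, dotp (p - x) p - d / (2 * k) < dotp (p - x) y.
  have := @dotp_continuous _ _ (p - x) p; move=> /cvgr_gt; apply.
  by rewrite ltrBlDr ltrDl.
have FS : FF (S (d / 2)) by exists (d / 2).
have [y [/= Sy [ny cy]]] := clp _ _ FS (filterI np cont).
apply: ny; apply: epi_mono Sy.
have := sqd_ge x y p; rewrite -/(q _) -/(q _) dotpDr dotpNr => qy.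
have : k / 2 * (q p + 2 * - (d / (2 * k))) <= k / 2 * q y.
  by rewrite ler_pM2l //; lra.
have -> : k / 2 * (q p + 2 * - (d / (2 * k))) = k / 2 * q p - d / 2.
  by field; rewrite gt_eqF.
rewrite /d; lra.
Qed.

(* The proximal point of x for a large parameter k yields a subgradient of f whose
   affine minorant exceeds r at x. *)
Lemma affine_minorant f x r : 0 <= r -> ~ epi f x r -> exists y b,
  (forall z v, epi f z v -> dotp y z - b <= v) /\ r < dotp y x - b.
Proof.
move=> r0 /epi_closed/near_sqd[e e0 he].
have e20 : 0 < e ^+ 2 by rewrite exprn_gt0.
(* The minorant will take the value a + k q at [x]. With this k, either a already exceeds r, or [p]
   is at distance at least e from [x] and k q >= r + 1. *)
pose k := (r + 1) / e ^+ 2; have k0 : 0 < k by rewrite divr_gt0 //; lra.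
have [p [m [fp hm]]] := proximal_point f x k0.
set q := dotp (p - x) (p - x) in fp; pose a := m - k / 2 * q.
have q0 : 0 <= q by exact: dotp_ge0.
exists (k *: (x - p)), (dotp (k *: (x - p)) p - a); split; last first.
  have -> : dotp (k *: (x - p)) x - (dotp (k *: (x - p)) p - a) = a + k * q.
    rewrite opprB addrCA -dotpNr -dotpDr dotpZl /q -(opprB x p).
    by rewrite dotpNl dotpNr opprK.
  have [ra|ar] := ltP r a; first by rewrite ltr_wpDr // mulr_ge0 // ltW.
  have : e ^+ 2 <= q.
    rewrite leNgt; apply/negP => /he; apply; exact: epi_mono fp.
  move=> /(ler_wpM2l (ltW k0)); rewrite {1}/k divfK ?gt_eqF //.
  have := epi_ge0 fp; rewrite -/a; lra.
move=> z v fz; rewrite opprB addrCA -dotpNr -dotpDr dotpZl.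
pose c := dotp (x - p) (z - p); rewrite -/c; pose l := dotp (z - p) (z - p).
have l0 : 0 <= l by exact: dotp_ge0.
(* Minimality of [p] against the points of the segment from [p] to [z], divided by t; below, t is
   taken so small that the last term is negligible. *)
have key t : 0 < t <= 1 -> a + k * c <= v + k / 2 * l * t.
  move=> /andP[t0 t1]; have t01 : 0 <= t <= 1 by rewrite (ltW t0).
  have := hm _ _ (epi_conv t01 fz fp).
  have -> : t *: z + (1 - t) *: p - x = t *: (z - p) - (x - p).
    rewrite scalerBl scale1r scalerBr opprB -!addrA; congr (_ + _).
    by rewrite addrCA addrC -addrA.
  rewrite dotp_sqrB -/l (dotpC (z - p)) -/c.
  have -> : dotp (x - p) (x - p) = q by rewrite /q -(opprB x p) dotpNl dotpNr opprK.
  rewrite -/a => h.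
  have : t * (a + k * c) <= t * (v + k / 2 * l * t).
    by move: h; rewrite /a; lra.
  by rewrite ler_pM2l.
apply/ler_addgt0Pr => d d0; pose t := Num.min 1 (d / (k / 2 * l + 1)).
have kl0 : 0 <= k / 2 * l by rewrite mulr_ge0 // divr_ge0 // ltW.
have kl1 : 0 < k / 2 * l + 1 by lra.
have t0 : 0 < t <= 1 by rewrite lt_min ltr01 divr_gt0 // ge_min lexx.
apply: (le_trans (key t t0)); rewrite lerD2l.
have : t <= d / (k / 2 * l + 1) by rewrite ge_min lexx orbT.
rewrite ler_pdivlMr //; case/andP: t0 => t0 _; nra.
Qed.

Lemma legendre_ge0 f y : (0 <= legendre (val f) y)%E.
Proof.
apply: ereal_sup_ubound; exists 0 => //.
by have /set_mem[_ -> _ _] := valP f; rewrite dotp0r sube0.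
Qed.

Lemma legendre_le f y b : (forall z v, epi f z v -> dotp y z - b <= v) ->
  (legendre (val f) y <= b%:E)%E.
Proof.
move=> h; apply: ge_ereal_sup => _ [z _ <-].
case E : (val f z) (cvx_ge0 f z) => [v||] // _; last by rewrite leNye.
by rewrite -EFinB lee_fin; have := h z v; rewrite /epi E lexx => /(_ isT); lra.
Qed.

Lemma legendre_ge f y z v : epi f z v -> ((dotp y z - v)%:E <= legendre (val f) y)%E.
Proof.
move=> fz; apply: (@le_trans _ _ ((dotp y z)%:E - val f z)%E).
  by rewrite EFinB leeD2l // leeN2.
by apply: ereal_sup_ubound; exists z.
Qed.

(** Both transforms unfold to linear inequalities: the left side says <x, y> - 1 <= s Lf(y) for
    every y, where the zeros of Lf give the polar condition. Divided by s, this bounds the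
    biconjugate of f at x/s by 1/s. *)
Lemma gauge_epi f x s : 0 < s ->
  (gauge_transform (val f) x <= s%:E)%E <-> epi f (s^-1 *: x) s^-1.
Proof.
move=> s0; pose g := legendre (val f).
have si0 : 0 < s^-1 by rewrite invr_gt0.
rewrite /gauge_transform /geometric_transform -/g; split.
  case: ifPn => [/set_mem px le_s|_]; last by rewrite leye_eq.
  apply: contrapT => nf.
  have [y [b [hb lt]]] := affine_minorant (ltW si0) nf.
  have gb : (g y <= b%:E)%E by exact: legendre_le.
  have xy : 1 + s * b < dotp x y.
    have := lt; rewrite dotpZr ltrBrDr -(ltr_pM2l s0) mulrDr mulfV ?gt_eqF //.
    by rewrite mulVKf ?gt_eqF // dotpC.
  have := legendre_ge0 f y; rewrite -/g le_eqVlt => /predU1P[g0|gp].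
    have := px y (esym g0); have : 0 <= b by rewrite -lee_fin (le_trans (legendre_ge0 f y)).
    by move=> /(mulr_ge0 (ltW s0)); lra.
  have : ((dotp x y - 1)%:E / g y <= s%:E)%E.
    apply: le_trans le_s; rewrite /Defs.sup0 ifF; first by apply: ereal_sup_ubound; exists y.
    by apply/negbTE/set0P; exists ((dotp x y - 1)%:E / g y)%E; exists y.
  case: (g y) gb gp => [c||] //; rewrite lee_fin lte_fin => cb c0.
  rewrite inver gt_eqF // -EFinM lee_fin ler_pdivrMr // => h.
  by have : s * c <= s * b by [rewrite ler_pM2l]; lra.
move=> fx; have key y c : g y = c%:E -> dotp x y - 1 <= s * c.
  move=> gc; have := legendre_ge y fx; rewrite -/g gc lee_fin dotpZr (dotpC y).
  by rewrite -(ler_pM2l s0) mulrBr mulVKf ?gt_eqF // mulfV ?gt_eqF.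
rewrite ifT; last first.
  apply/mem_set => y /= /key; rewrite mulr0; lra.
rewrite /Defs.sup0; case: ifPn => _; first by rewrite lee_fin ltW.
apply: ge_ereal_sup => _ [y /= gp <-].
case E : (g y) gp => [c||] // gp; last by rewrite invey mule0 lee_fin ltW.
rewrite lte_fin in gp; rewrite inver gt_eqF // -EFinM lee_fin ler_pdivrMr //.
exact: key.
Qed.

(** Not automatic, since a nonempty supremum in the geometric transform might be negative. A bound v
    < 0 would make Lf finite everywhere with <x, y> <= 1 + v Lf(y). A multiple of x refutes this for
    x != 0; for x = 0 it contradicts the growth of Lf in a direction where f is finite. *)
Lemma gauge_ge0 f x : (0 <= gauge_transform (val f) x)%E.
Proof.
rewrite leNgt; apply/negP => lt0; pose g := legendre (val f).
have {lt0} [v v0] : exists2 v, v < 0 & (gauge_transform (val f) x <= v%:E)%E.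
  case: (gauge_transform (val f) x) lt0 => [v||] // h; first by exists v.
  by exists (-1); rewrite ?leNye // ltrN10.
rewrite /gauge_transform /geometric_transform -/g.
case: ifPn => [/set_mem px|_]; last by rewrite leye_eq.
rewrite /Defs.sup0; case: ifPn => [_|/set0P[_ [y0 /= gy0 _]] le_v].
  by rewrite lee_fin leNgt v0.
have key y : exists2 c, g y = c%:E & 0 <= c /\ dotp x y <= 1 + v * c.
  have := legendre_ge0 f y; rewrite -/g le_eqVlt => /predU1P[g0|gp].
    by exists 0; rewrite -?g0 // mulr0 addr0; split=> //; exact: px.
  have : ((dotp x y - 1)%:E / g y <= v%:E)%E.
    by apply: le_trans le_v; apply: ereal_sup_ubound; exists y.
  (* If Lf(y) = +oo, the quotient is 0, which exceeds v. *)
  case: (g y) gp => [c||] // c0; last by rewrite invey mule0 lee_fin leNgt v0.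
  rewrite lte_fin in c0; rewrite inver gt_eqF // -EFinM lee_fin ler_pdivrMr // => h.
  by exists c => //; split; [exact: ltW | lra].
have [x0|x0] := eqVneq x 0; last first.
  have xx : 0 < dotp x x by rewrite dotp_gt0.
  have [c _ [c0]] := key ((2 / dotp x x) *: x).
  by rewrite dotpZr divfK ?gt_eqF //; nra.
have [z z0 [r fz]] : exists2 z, z != 0 & exists r, epi f z r.
  apply: contrapT => no; have : (g y0 <= 0)%E; last by rewrite leNgt gy0.
  apply: legendre_le => z r fz; have [->|z0] := eqVneq z 0.
    by rewrite dotp0r subr0; exact: epi_ge0 fz.
  by case: no; exists z => //; exists r.
have zz : 0 < dotp z z by rewrite dotp_gt0.
(* The factor makes <y, z> - r equal to 2 / (- v), twice what [key] at x = 0 allows for Lf(y). *)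
have [c gc [c0]] := key (((r + 2 * (- v)^-1) / dotp z z) *: z).
rewrite x0 dotp0l => cv; have := legendre_ge (((r + 2 * (- v)^-1) / dotp z z) *: z) fz.
rewrite -/g gc lee_fin dotpZl divfK ?gt_eqF // addrAC subrr add0r => h.
have : 2 * (- v)^-1 * (- v) <= c * (- v) by rewrite ler_pM2r ?oppr_gt0.
by rewrite -mulrA mulVf ?oppr_eq0 ?lt_eqF // mulr1; lra.
Qed.

End GaugeTransform.

Lemma down_closed_interval (R : realType) (D : R -> Prop) (t1 : R) :
  0 < t1 -> D t1 -> (forall s t, 0 <= s <= t -> D t -> D s) ->
  (forall t, 0 < t -> (forall s, 0 < s < t -> D s) -> D t) ->
  (forall t, 0 <= t -> D t) \/
  exists2 d, 0 < d & forall t, 0 <= t -> (D t <-> t <= d).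
Proof.
move=> t10 Dt1 down lim; have [ub|nub] := pselect (has_ubound D); last first.
  left=> t t0; apply: contrapT => nDt; apply: nub; exists t => s Ds.
  by rewrite leNgt; apply/negP => /ltW ts; apply: nDt; apply: down Ds; rewrite t0.
have hs : has_sup D by split; first by exists t1.
have d0 : 0 < sup D by apply: lt_le_trans t10 _; exact: ub_le_sup.
right; exists (sup D) => // t t0; split; first by move=> Dt; exact: ub_le_sup.
move=> td; apply: (@down _ (sup D)); first by rewrite t0.
apply: lim => // s /andP[s0 sd].
have e0 : 0 < sup D - s by rewrite subr_gt0.
have [v Dv] := sup_adherent e0 hs; rewrite subKr => sv.
by apply: down Dv; rewrite !ltW.
Qed.

(** * Almost order isomorphisms and functions carried by rays *)

Section RayFunctions.
Variables (R : realType) (n : nat).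
Implicit Types (f g h k p : Cvx0 R n) (x y z w u v : 'rV[R]_n).
Implicit Types (a b c d r s t : R).

Lemma epi_value f x r : epi f x r ->
  exists2 a, 0 <= a & forall s, epi f x s <-> a <= s.
Proof.
move=> fr; have f0 := cvx_ge0 f x; rewrite /epi in fr *.
case: (val f x) fr f0 => [a||] //.
by rewrite !lee_fin => _ a0; exists a => // s; rewrite lee_fin.
Qed.

(** By lower semicontinuity both functions exceed some s > r on a final piece [t x, x] of the
    segment. The hinge that vanishes up to t x and reaches s at x is at most s on this piece, and
    off the segment both functions are +oo. *)
Lemma hinge_below x p1 p2 r : x != 0 -> 0 <= r -> cle (seg x) p1 -> cle (seg x) p2 ->
  ~ epi p1 x r -> ~ epi p2 x r -> exists k, [/\ cle k p1, cle k p2 & ~ epi k x r].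
Proof.
move=> x0 r0 xp1 xp2 n1 n2.
have [s1 rs1 m1] := not_epi_gt n1; have [s2 rs2 m2] := not_epi_gt n2.
pose s := Num.min s1 s2; have rs : r < s by rewrite lt_min rs1.
have s0 : 0 < s by exact: le_lt_trans rs.
have {m1} m1 : ~ epi p1 x s.
  by move=> e; apply: m1; apply: epi_mono e; rewrite ge_min lexx.
have {m2} m2 : ~ epi p2 x s.
  by move=> e; apply: m2; apply: epi_mono e; rewrite ge_min lexx orbT.
have [t1 /andP[t10 t11] h1] := epi_near_ray m1.
have [t2 /andP[t20 t21] h2] := epi_near_ray m2.
pose t := Num.max t1 t2.
have t0 : 0 < t by rewrite lt_max t10.
have t1' : t < 1 by rewrite gt_max t11.
have d0 : 0 < (1 - t) / s by rewrite divr_gt0 // subr_gt0.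
have [k kP] := hinge (dualv x) (ltW t0) d0.
have below p tt : tt <= t -> cle (seg x) p ->
    (forall c, tt <= c <= 1 -> ~ epi p (c *: x) s) -> cle k p.
  move=> ttt xp hp; apply/cleP => y r' yr'; have r'0 := epi_ge0 yr'.
  apply/kP; split=> //; have /cleP/(_ _ _ yr')/segP[_ [u /andP[u0 u1] ey]] := xp.
  rewrite ey dotpZr dotp_dualv // mulr1.
  have [ut|tu] := leP u t; first by rewrite (le_trans ut) // lerDl mulr_ge0 // ltW.
  have sr : s <= r'.
    rewrite leNgt; apply/negP => /ltW r's; apply: (hp u).
      by rewrite u1 andbT (le_trans ttt) ?ltW.
    by rewrite -ey; exact: epi_mono yr'.
  have : (1 - t) / s * s <= (1 - t) / s * r' by rewrite ler_pM2l.
  by rewrite divfK ?gt_eqF //; lra.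
exists k; split.
- by apply: below h1 => //; rewrite le_max lexx.
- by apply: below h2 => //; rewrite le_max lexx orbT.
- move=> /kP[_]; rewrite dotp_dualv // leNgt => /negP; apply.
  have : (1 - t) / s * r < (1 - t) / s * s by rewrite ltr_pM2l.
  by rewrite divfK ?gt_eqF //; lra.
Qed.

Lemma onray_change u v z s t f : z != 0 -> z = s *: u -> z = t *: v ->
  0 <= s -> 0 <= t -> onray u f -> onray v f.
Proof.
move=> z0 zs zt s0 t0 fu y r /fu[a a0 ->].
have sn0 : s != 0 by apply: contraNneq z0 => e; rewrite zs e scale0r.
exists (a * (t / s)); first by rewrite mulr_ge0 ?divr_ge0.
by rewrite -scalerA mulrC -scalerA -zt zs (scalerA s^-1) mulVf // scale1r.
Qed.

(* [g] is the infimum of its truncation at t u and of the function obtained from [g]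
   by replacing its graph over [0, s u] by a chord. *)
Lemma chord_truncation u g s t a : u != 0 -> 0 < s < t -> onray u g ->
  (forall b, epi g (s *: u) b <-> a <= b) -> forall k,
  cle k (cvx_max g (seg (t *: u))) -> cle k (cvx_max g (lin (s *: u) a)) -> cle k g.
Proof.
move=> u0 /andP[s0 st] gu ga k /cleP k1 /cleP k2; apply/cleP => y r /[dup] gy /gu[c c0 ey].
have r0 := epi_ge0 gy; subst y; have t0 : 0 < t by exact: lt_trans st.
have [ct|tc] := leP c t.
  apply: k1; apply/cvx_maxP; split=> //; apply/segP; split=> //.
  exists (c / t); first by rewrite divr_ge0 ?(ltW t0) //= ler_pdivrMr // mul1r.
  by rewrite scalerA divfK ?gt_eqF.
apply: k2; apply/cvx_maxP; split=> //; apply/linP; split=> //.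
have cp : 0 < c by exact: lt_trans tc.
exists (c / s); split; last by rewrite scalerA divfK ?gt_eqF.
  by rewrite divr_ge0 // ltW.
have : epi g (s *: u) (s / c * r).
  have := @epi_scale _ _ g (c *: u) r (s / c).
  rewrite scalerA divfK ?gt_eqF //; apply=> //.
  by rewrite divr_ge0 ?(ltW s0) ?(ltW cp) //= ler_pdivrMr // mul1r; lra.
have cs0 : 0 <= c / s by rewrite divr_ge0 // ltW.
move=> /ga /(ler_wpM2r cs0) /le_trans; apply; rewrite le_eqVlt; apply/orP; left.
by apply/eqP; field; rewrite !gt_eqF.
Qed.

(* The possible images of the indicator of a segment: they are irreducible for
   suprema and infima among the functions carried by a ray. *)
Lemma ray_shape u g : u != 0 -> onray u g -> g <> ctop R n ->
  (forall h1 h2, cle g h1 -> cle g h2 ->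
     (forall k, cle k h1 -> cle k h2 -> cle k g) -> h1 = g \/ h2 = g) ->
  (forall h1 h2, onray u h1 -> onray u h2 -> cle h1 g -> cle h2 g ->
     (forall k, cle h1 k -> cle h2 k -> cle g k) -> h1 = g \/ h2 = g) ->
  exists2 t, 0 < t & [\/ g = seg (t *: u), g = lin (t *: u) 1 | g = lin u 0].
Proof.
move=> u0 gu gt INF SUP.
(* [INF] is applied to the decomposition of [chord_truncation]. The truncation at m u differs from
   [g], which is finite at t u, so [g] dominates the line through its own value at s u. Convexity
   gives this beyond s u; the gain is the part before it. *)
have slope s t a r : 0 < s < t -> epi g (t *: u) r ->
    (forall b, epi g (s *: u) b <-> a <= b) -> cle (lin (s *: u) a) g.
  move=> /andP[s0 st] gtr ga.
  pose m := (s + t) / 2.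
  have sm : s < m by rewrite /m; lra.
  have m0 : 0 < m by exact: lt_trans sm.
  have mt : m < t by rewrite /m; lra.
  pose h1 := cvx_max g (seg (m *: u)); pose h2 := cvx_max g (lin (s *: u) a).
  have [|e1|e2] := INF h1 h2 (cle_maxl _ _) (cle_maxl _ _).
  - by apply: chord_truncation => //; rewrite s0.
  - have : epi h1 (t *: u) r by rewrite e1.
    move=> /cvx_maxP[_ /segP[_ [s' /andP[_ s'1]]]]; rewrite scalerA => /(scalerIr u0) ts.
    by have : s' * m <= 1 * m; [rewrite ler_wpM2r // ltW | rewrite mul1r -ts; lra].
  - by rewrite -e2; exact: cle_maxr.
have [t1 t10 [r1 gt1]] := onray_epi_pos gu gt.
pose s0 := t1 / 2; have s00 : 0 < s0 by rewrite /s0; lra.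
have s0t : s0 < t1 by rewrite /s0; lra.
have [a0 a00 ga0] : exists2 a, 0 <= a & forall s, epi g (s0 *: u) s <-> a <= s.
  by apply: (@epi_value _ _ r1); apply: epi_segment gt1; rewrite !ltW.
pose m := a0 / s0; have m0 : 0 <= m by rewrite divr_ge0 // ltW.
have low t r : 0 <= t -> epi g (t *: u) r -> m * t <= r.
  move=> tp gr; have s0b : 0 < s0 < t1 by rewrite s00.
  have /cleP/(_ _ _ gr)/linP[_ [t' [t'0 h]]] := slope _ _ _ _ s0b gt1 ga0.
  rewrite scalerA => /(scalerIr u0) ->.
  by rewrite mulrC -mulrA /m (mulrC a0) mulVKf ?gt_eqF // mulrC.
have up t r : 0 <= t -> epi g (t *: u) r -> epi g (t *: u) (m * t).
  rewrite le_eqVlt => /predU1P[<-|t0 gr].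
    by rewrite scale0r mulr0 => _; exact: epi0.
  apply: epi_ray_lim => c /andP[c0 c1]; rewrite scalerA.
  have ct : c * t < t by rewrite gtr_pMl.
  have ct0 : 0 < c * t by rewrite mulr_gt0.
  have [a ap ga] : exists2 a, 0 <= a & forall s, epi g ((c * t) *: u) s <-> a <= s.
    by apply: (@epi_value _ _ r); apply: epi_segment gr; rewrite !ltW.
  apply/ga; have ctb : 0 < c * t < t by rewrite ct0.
  have g0 : epi g (s0 *: u) a0 by apply/ga0.
  have /cleP/(_ _ _ g0)/linP[_ [t' [t'0 h]]] := slope _ _ _ _ ctb gr ga.
  rewrite scalerA => /(scalerIr u0) e.
  have -> : a = a * t' / s0 * (c * t).
    have h' : a = a * (t' * (c * t)) / s0 by rewrite -e mulfK ?gt_eqF.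
    by apply: (etrans h'); ring.
  have : a * t' / s0 <= m by rewrite ler_pM2r ?invr_gt0.
  move=> /(ler_wpM2r (ltW ct0)) /le_trans; apply.
  by apply: ler_wpM2l => //; exact: ltW.
pose D t := exists r, epi g (t *: u) r.
have gE t r : 0 <= t -> epi g (t *: u) r <-> D t /\ m * t <= r.
  move=> tp; split=> [gr|[[r' gr'] h]].
    by split; [exists r | exact: low gr].
  by apply: epi_mono h _; exact: up gr'.
have Dd s t : 0 <= s <= t -> D t -> D s.
  by move=> st [r gr]; exists r; exact: epi_segment gr.
have Dl t : 0 < t -> (forall s, 0 < s < t -> D s) -> D t.
  move=> t0 h; exists (m * t); apply: epi_ray_lim => c /andP[c0 c1].
  rewrite scalerA; apply/gE; first by rewrite ltW // mulr_gt0.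
  split; first by apply: h; rewrite mulr_gt0 //= gtr_pMl.
  by apply: ler_wpM2l => //; rewrite ltW // gtr_pMl.
have Dt1 : D t1 by exists r1.
have [Dall|[d d0 Dle]] := down_closed_interval t10 Dt1 Dd Dl.
  have e : g = lin u m.
    apply: cvx_ext => y r; split=> [/[dup] /epi_ge0 r0 /[dup] gy /gu[t tp ey]|].
      apply/linP; split=> //; exists t; split=> //.
      by apply: low; rewrite -?ey.
    by move=> /linP[r0 [t [tp h ->]]]; apply/gE => //; split=> //; exact: Dall.
  have [mz|mn] := eqVneq m 0; first by exists 1 => //; apply: Or33; rewrite e mz.
  have mp : 0 < m by rewrite lt_def mn.
  exists m^-1; first by rewrite invr_gt0.
  apply: Or32; rewrite e; apply: cvx_ext => y r; split.
    move=> /linP[r0 [t [tp h ->]]]; apply/linP; split=> //; exists (m * t).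
    split; first by rewrite mulr_ge0.
      by rewrite mul1r.
    by rewrite scalerA (mulrC m) mulfK.
  move=> /linP[r0 [t [tp h ->]]]; apply/linP; split=> //; exists (t * m^-1).
  split; rewrite ?scalerA // ?mulr_ge0 ?invr_ge0 //.
  by rewrite mulrCA divff // mulr1 -[t]mul1r.
exists d => //; pose v := d *: u.
have vE t : t *: v = (t * d) *: u by rewrite scalerA.
have gv y r : epi g y r <->
    0 <= r /\ exists t, [/\ 0 <= t, t <= 1, m * (t * d) <= r & y = t *: v].
  split=> [/[dup] /epi_ge0 r0 /[dup] gy /gu[t tp ey]|[r0 [t [tp t1' h ->]]]].
    split=> //; exists (t / d); rewrite vE divfK ?gt_eqF //; subst y.
    have [/(Dle _ tp) td mt] := (gE _ _ tp).1 gy.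
    by rewrite divr_ge0 ?(ltW d0) //= ler_pdivrMr // mul1r.
  rewrite vE; apply/gE; first by rewrite mulr_ge0 // ltW.
  by split=> //; apply/Dle; rewrite ?mulr_ge0 // ?(ltW d0) // ger_pMl.
have [mz|mn] := eqVneq m 0.
  apply: Or31; apply: cvx_ext => y r; rewrite gv segP.
  split=> [[r0 [t [tp t1' _ ->]]]|[r0 [t /andP[tp t1'] ->]]].
    by split=> //; exists t => //; rewrite tp.
  by split=> //; exists t; rewrite mz mul0r.
have mp : 0 < m by rewrite lt_def mn.
have vd : v = d *: u by [].
(* A line of positive slope cut off at v is the maximum of [seg v] and [lin u m] without being
   either, which [SUP] forbids. *)
have [| | | |k|e|e] := SUP (seg v) (lin u m).
- apply: (@onray_change v u v 1 d) => //; last exact: seg_onray.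
  - by rewrite scaler_eq0 negb_or gt_eqF.
  - by rewrite scale1r.
  - exact: ltW.
- exact: lin_onray.
- apply/cleP => y r /gv[r0 [t [tp t1' _ ->]]]; apply/segP; split=> //.
  by exists t => //; rewrite tp.
- apply/cleP => y r /gv[r0 [t [tp t1' h ->]]]; apply/linP; split=> //.
  by exists (t * d); rewrite vE mulr_ge0 // ltW.
- move=> /cleP k1 /cleP k2; apply/cleP => y r ky; apply/gv.
  have /segP[r0 [t /andP[tp t1'] ey]] := k1 _ _ ky; split=> //.
  exists t; split=> //; have /linP[_ [t' [t'p h]]] := k2 _ _ ky.
  by rewrite ey vE => /(scalerIr u0) ->.
- have : epi g v 0 by rewrite -e; exact: epi_seg.
  move=> /gE [|_]; first exact: ltW.
  by rewrite leNgt mulr_gt0.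
- have : epi g ((d + 1) *: u) (m * (d + 1)).
    have d1 : 0 <= d + 1 by rewrite addr_ge0 // ltW.
    by rewrite -e; apply: epi_lin => //; rewrite mulr_ge0.
  move=> /gE [|]; first by rewrite addr_ge0 // ltW.
  by rewrite Dle; [lra | rewrite addr_ge0 // ltW].
Qed.

End RayFunctions.

(** * Relations preserved by almost order isomorphisms *)

Section AlmostIsomorphism.
Variables (R : realType) (n : nat) (C : R).
Hypothesis C1 : 1 < C.
Implicit Types (f g h k p : Cvx0 R n) (x y z w u v : 'rV[R]_n).
Implicit Types (a b c d r s t : R) (T : Cvx0 R n -> Cvx0 R n).

Let C0 : 0 < C. Proof. exact: lt_trans ltr01 C1. Qed.
Let Cn0 : C != 0. Proof. by rewrite gt_eqF. Qed.
Let Ci0 : 0 < C^-1. Proof. by rewrite invr_gt0. Qed.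

Record almost_iso T T' : Prop := AlmostIso {
  iso_TK : cancel T T';
  iso_KT : cancel T' T;
  iso_T : almost_order_preserving C T;
  iso_T' : almost_order_preserving C T' }.

Lemma iso_sym T T' : almost_iso T T' -> almost_iso T' T.
Proof. by case=> *; split. Qed.

Lemma iso_le T T' f g : almost_iso T T' -> cle f g ->
  forall x r, epi (T g) x r -> epi (T f) x (C * r).
Proof.
move=> H fg x r Tg; have := (iso_T H).1 f g fg x; rewrite /epi => /le_trans; apply.
by rewrite EFinM; apply: lee_wpmul2l => //; rewrite lee_fin ltW.
Qed.

Lemma iso_scale T T' f g : almost_iso T T' ->
  (forall x r, epi g x r -> epi f x (r / C)) -> cle (T f) (T g).
Proof.
move=> H fg; apply: (iso_T H).2 => x.
case E : (val g x) (cvx_ge0 g x) => [v||] //.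
- move=> _; rewrite -EFinM mulrC; apply: fg; by rewrite /epi E.
- by move=> _; rewrite gt0_muley ?lte_fin // leey.
Qed.

Lemma iso_exact1 T T' f g : almost_iso T T' ->
  [\/ indicator f, indicator g, indicator (T f) | indicator (T g)] ->
  cle f g -> cle (T f) (T g).
Proof.
move=> H [i|i|i|i] fg.
- apply: (iso_scale H) => x r gx; have r0 := epi_ge0 gx.
  apply: (@epi_mono _ _ _ _ 0); first by rewrite divr_ge0 // ltW.
  by apply: (i _ r); exact: (cleP _ _).1 fg _ _ gx.
- apply: (iso_scale H) => x r gx; have r0 := epi_ge0 gx.
  apply: (@epi_mono _ _ _ _ 0); first by rewrite divr_ge0 // ltW.
  by apply: (cleP _ _).1 fg _ _ _; exact: i gx.
- apply/cleP => x r gx; apply: epi_mono (epi_ge0 gx) _.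
  by apply: i; exact: (iso_le H fg gx).
- apply/cleP => x r gx; apply: epi_mono (epi_ge0 gx) _.
  by rewrite -[0](mulr0 C); apply: (iso_le H fg); exact: i gx.
Qed.

Lemma iso_exact2 T T' f g : almost_iso T T' ->
  [\/ indicator f, indicator g, indicator (T f) | indicator (T g)] ->
  cle (T f) (T g) -> cle f g.
Proof.
move=> H i /(iso_exact1 (iso_sym H)); rewrite !(iso_TK H); apply.
by case: i => i; [apply: Or43 | apply: Or44 | apply: Or41 | apply: Or42].
Qed.

Lemma iso_exact T T' f g : almost_iso T T' ->
  [\/ indicator f, indicator g, indicator (T f) | indicator (T g)] ->
  cle f g <-> cle (T f) (T g).
Proof.
by move=> H i; split; [exact: iso_exact1 H i | exact: iso_exact2 H i].
Qed.

Lemma iso_ctop T T' : almost_iso T T' -> T (ctop R n) = ctop R n.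
Proof.
move=> H; apply: cle_anti; first exact: cle_top.
rewrite -{1}(iso_KT H (ctop R n)); apply: (iso_exact1 H).
  by apply: Or42; exact: seg_indicator.
exact: cle_top.
Qed.

Lemma iso_neq_ctop T T' f : almost_iso T T' -> f <> ctop R n -> T f <> ctop R n.
Proof.
by move=> H fn e; apply: fn; rewrite -(iso_TK H f) e; exact: (iso_ctop (iso_sym H)).
Qed.

(** The image of C max(f, g) lies above both images, and it is not [ctop]. *)
Lemma iso_compat T T' f g : almost_iso T T' -> compat f g -> compat (T f) (T g).
Proof.
move=> H [x [r [x0 fx gx]]]; pose m := cvx_scale C0 (cvx_max f g).
have mt : T m <> ctop R n.
  apply: (iso_neq_ctop H); apply: (@neq_ctop_epi _ _ _ _ (C * r) x0).
  by apply/cvx_scaleP; rewrite mulrAC divff // mul1r; apply/cvx_maxP.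
have [y [s [y0 my]]] := neq_ctop mt.
have fm h : (forall z t, epi m z t -> epi h z (t / C)) -> epi (T h) y s.
  by move=> hm; have /cleP := iso_scale H hm; exact.
by exists y, s; split=> //; apply: fm => z t /cvx_scaleP/cvx_maxP[].
Qed.

Lemma iso_compat2 T T' f g : almost_iso T T' -> compat (T f) (T g) -> compat f g.
Proof. by move=> H /(iso_compat (iso_sym H)); rewrite !(iso_TK H). Qed.

Lemma iso_le' T T' f g : almost_iso T T' -> cle (T f) (T g) ->
  forall x r, epi g x r -> epi f x (C * r).
Proof. by move=> H /(iso_le (iso_sym H)); rewrite !(iso_TK H). Qed.

Lemma iso_scale' T T' f g : almost_iso T T' ->
  (forall x r, epi (T g) x r -> epi (T f) x (r / C)) -> cle f g.
Proof. by move=> H /(iso_scale (iso_sym H)); rewrite !(iso_TK H). Qed.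

(** For nonzero points u and v where T f is finite, restrict T f to the rays of u and of v. The
    preimages of the restrictions are at least f / C, so both live on the ray of x and are
    compatible. Hence so are the restrictions, and the two rays coincide. *)
Lemma iso_onray T T' x f : almost_iso T T' -> x != 0 -> f <> ctop R n -> onray x f ->
  exists2 u, u != 0 & onray u (T f).
Proof.
move=> H x0 fn fx; have [u [r [u0 fu]]] := neq_ctop (iso_neq_ctop H fn).
exists u => // v s fv; have [->|v0] := eqVneq v 0; first by exists 0; rewrite ?scale0r.
pose h w := cvx_max (T f) (lin w 0).
have hw w c : w != 0 -> epi (T f) w c -> onray x (T' (h w)) /\ T' (h w) <> ctop R n.
  move=> w0 fw; split.
    move=> y t hy; apply: (fx _ (C * t)); apply: (iso_le' H _ hy).
    by rewrite (iso_KT H); exact: cle_maxl.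
  apply: (iso_neq_ctop (iso_sym H)); apply: (@neq_ctop_epi _ _ _ w c w0).
  apply/cvx_maxP; split=> //; apply/linP; split; first exact: epi_ge0 fw.
  by exists 1; rewrite ler01 scale1r mul0r; split=> //; exact: epi_ge0 fw.
have [hu1 hu2] := hw _ _ u0 fu; have [hv1 hv2] := hw _ _ v0 fv.
have := compat_onray x0 hu1 hv1 hu2 hv2.
move=> /(iso_compat H)[y [t [y0 hy1 hy2]]].
move: hy1 hy2; rewrite !(iso_KT H) => /cvx_maxP[_ /linP[_ [a [a0 _ ya]]]].
move=> /cvx_maxP[_ /linP[_ [b [b0 _ yb]]]].
have bn : b != 0 by apply: contraNneq y0 => e; rewrite yb e scale0r.
exists (b^-1 * a); first by rewrite mulr_ge0 // invr_ge0.
by rewrite -scalerA -ya yb scalerA mulVf // scale1r.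
Qed.

Lemma iso_onray_eq T T' x u f g : almost_iso T T' -> x != 0 -> u != 0 ->
  f <> ctop R n -> g <> ctop R n -> onray x f -> onray x g ->
  onray u (T f) -> onray u (T g).
Proof.
move=> H x0 u0 fn gn fx gx fu; have [v v0 gv] := iso_onray H x0 gn gx.
have [y [t [y0 /fu[a a0 ya] /gv[b b0 yb]]]] := iso_compat H (compat_onray x0 fx gx fn gn).
exact: (onray_change y0 yb ya b0 a0).
Qed.

Lemma seg_neq_ctop x : x != 0 -> seg x <> ctop R n.
Proof. by move=> x0; exact: neq_ctop_epi x0 (epi_seg x). Qed.

Lemma lin_neq_ctop x a : x != 0 -> 0 <= a -> lin x a <> ctop R n.
Proof.
move=> x0 a0; apply: (@neq_ctop_epi _ _ _ x (a * 1) x0).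
by rewrite -{2}(scale1r x); apply: epi_lin; rewrite ?mulr1.
Qed.

(** [lin x 0] and [lin u 0] are the least functions carried by their rays; as these are indicators,
    being least is transported without loss. *)
Lemma iso_lin0 T T' x u : almost_iso T T' -> x != 0 -> u != 0 ->
  onray u (T (seg x)) -> T (lin x 0) = lin u 0.
Proof.
move=> H x0 u0 su.
have lu : onray u (T (lin x 0)).
  apply: (iso_onray_eq H x0 u0 _ _ _ _ su); [exact: seg_neq_ctop
    | exact: lin_neq_ctop | exact: seg_onray | exact: lin_onray].
apply: cle_anti; last exact: cle_onray.
have ind : indicator (lin u 0).
  by move=> y r /linP[_ [t [t0 _ ->]]]; apply/linP; split=> //; exists t; rewrite mul0r.
rewrite -[X in cle _ X](iso_KT H).
have i4 : indicator (T (T' (lin u 0))) by rewrite (iso_KT H).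
apply: (iso_exact1 H (Or44 _ _ _ i4)); apply: cle_onray.
apply: (iso_onray_eq (iso_sym H) u0 x0 _ _ lu).
- by apply: (iso_neq_ctop H); exact: lin_neq_ctop.
- exact: lin_neq_ctop.
- exact: lin_onray.
- by rewrite (iso_TK H); exact: lin_onray.
Qed.

(** If both preimages exceeded C^2 r at x, some k below both would too. Then T (k / C) is below h1
    and h2, hence below T f, so that k / C <= C f, which fails at x. *)
Lemma image_inf T T' f x r h1 h2 : almost_iso T T' -> x != 0 -> cle (seg x) f ->
  0 <= r -> cle (T f) h1 -> cle (T f) h2 ->
  (forall k, cle k h1 -> cle k h2 -> cle k (T f)) ->
  epi f x r -> epi (T' h1) x (C * (C * r)) \/ epi (T' h2) x (C * (C * r)).
Proof.
move=> H x0 xf r0 fh1 fh2 hk fr.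
have [e1|n1] := pselect (epi (T' h1) x (C * (C * r))); first by left.
right; apply: contrapT => n2.
have xp h : cle (T f) h -> cle (seg x) (T' h).
  move=> fh; apply/cleP => y s hy.
  have fy : epi f y (C * s) by apply: (iso_le' H _ hy); rewrite (iso_KT H).
  apply: (@epi_mono _ _ _ _ 0); first exact: epi_ge0 hy.
  by move/cleP: xf => /(_ _ _ fy) /seg_indicator.
have Cr0 : 0 <= C * (C * r) by rewrite !mulr_ge0 ?(ltW C0).
have [k [k1 k2 nk]] := hinge_below x0 Cr0 (xp _ fh1) (xp _ fh2) n1 n2.
have low h : cle k (T' h) -> cle (T (cvx_scale Ci0 k)) h.
  move=> kh; rewrite -[h](iso_KT H); apply: (iso_scale H) => y s hy.
  by apply/cvx_scaleP; rewrite invrK divfK //; move/cleP: kh; apply.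
have /(iso_le' H)/(_ _ _ fr) := hk _ (low _ k1) (low _ k2).
by move=> /cvx_scaleP; rewrite invrK mulrC.
Qed.

Lemma seg_shape T T' x : almost_iso T T' -> x != 0 ->
  exists2 u, u != 0 & T (seg x) = seg u \/ T (seg x) = lin u 1.
Proof.
move=> H x0; have sn := seg_neq_ctop x0.
have [u u0 su] := iso_onray H x0 sn (@seg_onray _ _ x).
have ex f : cle (seg x) f <-> cle (T (seg x)) (T f).
  by apply: (iso_exact H); apply: Or41; exact: seg_indicator.
have ex' f : cle f (seg x) <-> cle (T f) (T (seg x)).
  by apply: (iso_exact H); apply: Or42; exact: seg_indicator.
have [| |t t0] := ray_shape u0 su (iso_neq_ctop H sn).
- move=> h1 h2 h1g h2g hk.
  have eq h : cle (T (seg x)) h -> epi (T' h) x 0 -> h = T (seg x).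
    move=> hg hx; rewrite -[h](iso_KT H); congr T; apply: cle_anti; first exact/cle_seg.
    by apply/ex; rewrite (iso_KT H).
  (* At r = 0 the factor C^2 disappears. *)
  have := image_inf H x0 (@cle_refl _ _ (seg x)) (lexx 0) h1g h2g hk (epi_seg x).
  by rewrite !mulr0 => -[/eq|/eq] e; [left | right]; exact: e.
- move=> h1 h2 h1u h2u h1g h2g hk.
  have eq h : cle h (T (seg x)) -> cle (seg x) (T' h) -> h = T (seg x).
    move=> hg hx; rewrite -[h](iso_KT H); congr T; apply: cle_anti => //.
    by apply/ex'; rewrite (iso_KT H).
  have [e1|n1] := pselect (cle (seg x) (T' h1)); first by left; exact: eq.
  have [e2|n2] := pselect (cle (seg x) (T' h2)); first by right; exact: eq.
  (* A preimage that is not above [seg x] is finite somewhere past x on the ray. If this held for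
     both, C times their maximum would be finite at some a x with a > 1, although its image
     dominates T (seg x). *)
  have beyond h : onray u h -> cle h (T (seg x)) -> ~ cle (seg x) (T' h) ->
      exists2 a, 1 < a & exists r, epi (T' h) (a *: x) r.
    move=> hu hg nx.
    have hx : onray x (T' h).
      apply: (iso_onray_eq (iso_sym H) u0 x0 _ _ su hu).
      - exact: (iso_neq_ctop H).
      - by apply: cle_neq_ctop hg _; exact: (iso_neq_ctop H).
      - by rewrite (iso_TK H); exact: seg_onray.
    apply: contrapT => no; apply: nx; apply/cleP => y r /[dup] hy /hx[a a0 ya].
    apply/segP; split; first exact: epi_ge0 hy.
    exists a => //; rewrite a0 leNgt; apply/negP => a1; apply: no; exists a => //.
    by exists r; rewrite -ya.
  have [a1 a11 [r1 e1]] := beyond _ h1u h1g n1.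
  have [a2 a21 [r2 e2]] := beyond _ h2u h2g n2.
  pose a := Num.min a1 a2; have a_gt1 : 1 < a by rewrite lt_min a11.
  have a0 : 0 <= a by rewrite ltW // (lt_trans ltr01).
  pose k := cvx_scale C0 (cvx_max (T' h1) (T' h2)).
  have kg : cle (T (seg x)) (T k).
    apply: hk; rewrite -[X in cle X _](iso_KT H); apply: (iso_scale H);
      by move=> y s /cvx_scaleP/cvx_maxP[].
  have : epi k (a *: x) (C * Num.max r1 r2).
    apply/cvx_scaleP; rewrite mulrAC divff // mul1r; apply/cvx_maxP; split.
      apply: (@epi_segment _ _ _ _ _ a1); first by rewrite a0 ge_min lexx.
      by apply: epi_mono e1; rewrite le_max lexx.
    apply: (@epi_segment _ _ _ _ _ a2); first by rewrite a0 ge_min lexx orbT.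
    by apply: epi_mono e2; rewrite le_max lexx orbT.
  move/ex: kg => /cleP kg /kg /(epi_segE _ _ x0)[_ /andP[_]].
  by rewrite leNgt a_gt1.
- move=> [e|e|e]; [by exists (t *: u); [rewrite scaler_eq0 negb_or gt_eqF | left]
    | by exists (t *: u); [rewrite scaler_eq0 negb_or gt_eqF | right]|].
  (* The third shape is already the image of [lin x 0]. *)
  have := iso_lin0 H x0 u0 su; rewrite -e => /(can_inj (iso_TK H)) e'.
  have : epi (seg x) (2 *: x) 0.
    by rewrite -e'; apply/linP; split=> //; exists 2; rewrite mul0r ler0n.
  by move=> /(epi_segE _ _ x0)[_]; lra.
Qed.

Lemma iso_indep_ray T T' x y u v q a b : almost_iso T T' -> indep x y ->
  onray u (T (seg x)) -> onray v (T (seg y)) -> q != 0 ->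
  0 <= a -> 0 <= b -> q = a *: u -> q <> b *: v.
Proof.
move=> H xy ux vy q0 a0 b0 qa qb.
have nc z : z != 0 -> T (seg z) <> ctop R n.
  by move=> z0; apply: (iso_neq_ctop H); exact: seg_neq_ctop.
have q1 : q = 1 *: q by rewrite scale1r.
have qx := onray_change q0 qa q1 a0 ler01 ux.
have qy := onray_change q0 qb q1 b0 ler01 vy.
have := compat_onray q0 qx qy (nc _ (indep_neq0 xy)) (nc _ (indep_neq0 (indepC xy))).
by move=> /(iso_compat2 H); apply: (indep_compat xy) => //; exact: seg_onray.
Qed.

(** Were u and v collinear, the preimage of the indicator of their line would vanish at x and y,
    hence at their midpoint m. So T (seg m) would live on that line and meet the ray of u or that of
    v, although m is independent of both x and y. *)
Lemma iso_indep T T' x y u v : almost_iso T T' -> indep x y ->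
  u != 0 -> v != 0 -> onray u (T (seg x)) -> onray v (T (seg y)) -> indep u v.
Proof.
move=> H xy u0 v0 ux vy; apply: indepP => // t vt.
have ex h z : cle h (T (seg z)) -> epi (T' h) z 0.
  move=> hz; apply/cle_seg; apply: (iso_exact2 H); rewrite ?(iso_KT H) //.
  by apply: Or42; exact: seg_indicator.
have lx : epi (T' (line u)) x 0.
  apply: ex; apply/cleP => q r /[dup] /epi_ge0 r0 /ux[c _ ->].
  by apply/lineP; split=> //; exists c.
have ly : epi (T' (line u)) y 0.
  apply: ex; apply/cleP => q r /[dup] /epi_ge0 r0 /vy[c _ ->].
  by apply/lineP; split=> //; exists (c * t); rewrite vt scalerA.
pose m := 2^-1 *: x + 2^-1 *: y.
have lm : epi (T' (line u)) m 0.
  have := @epi_comb _ _ (T' (line u)) x y 0 0 2^-1 2^-1.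
  by rewrite !mulr0 addr0; apply=> //; lra.
have xm : indep x m by exact: indep_mid.
have ym : indep y m by exact: indep_mid2.
have m0 := indep_neq0 (indepC xm).
have [w w0 mw] := iso_onray H m0 (seg_neq_ctop m0) (@seg_onray _ _ m).
have [q [r [q0 mq]]] := neq_ctop (iso_neq_ctop H (seg_neq_ctop m0)).
have [a a0 qa] := mw _ _ mq.
have [b qb] : exists b, q = b *: u.
  have : cle (line u) (T (seg m)).
    rewrite -[X in cle X _](iso_KT H); apply: (iso_exact1 H); last exact/cle_seg.
    by apply: Or42; exact: seg_indicator.
  by move=> /cleP/(_ _ _ mq)/lineP[].
have b0 : b != 0 by apply: contraNneq q0 => e; rewrite qb e scale0r.
have [bp|bn] := leP 0 b; first exact: (iso_indep_ray H xm ux mw q0 bp a0 qb qa).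
have [tp|tn] := leP 0 t.
  by apply: (iso_indep_ray H xy ux vy v0 tp ler01 vt); rewrite scale1r.
have bt : 0 <= b / t by rewrite -mulrNN mulr_ge0 ?oppr_ge0 ?invr_le0 // ltW.
apply: (iso_indep_ray H ym vy mw q0 bt a0 _ qa).
by rewrite vt scalerA divfK // lt_eqF.
Qed.

End AlmostIsomorphism.

(** * Bijections preserving triangles with vertex 0 are linear *)

Section IndepExistence.
Variables (R : realType) (n : nat).
Hypothesis n2 : (2 <= n)%N.
Implicit Types (x y z : 'rV[R]_n).

Lemma exists_neq0 : exists x : 'rV[R]_n, x != 0.
Proof.
exists (delta_mx 0 (Ordinal n2)); apply/eqP => /rowP/(_ (Ordinal n2)).
by rewrite !mxE !eqxx => /eqP; rewrite oner_eq0.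
Qed.

Lemma exists_indep x : x != 0 -> exists z, indep x z.
Proof.
move=> x0; have [i xi] : exists i, x 0 i != 0.
  by apply/existsP; apply: contraNT x0 => /existsPn h; apply/eqP/rowP => i;
     rewrite mxE; apply/eqP; have := h i; rewrite negbK.
have [j ji] : exists j, j != i.
  have [/eqP ei|ei] := eqVneq (i : nat) 0%N.
    by exists (Ordinal n2); apply: contraTneq ei => <-.
  by exists (Ordinal (ltnW n2)); apply: contra ei => /eqP <-.
exists (delta_mx 0 j); apply: indepP => // t e.
have := congr1 (fun v : 'rV[R]_n => v 0 i) e; rewrite !mxE eqxx eq_sym (negbTE ji).
move=> /esym/eqP; rewrite mulf_eq0 (negbTE xi) orbF => /eqP t0.
have := congr1 (fun v : 'rV[R]_n => v 0 j) e; rewrite !mxE !eqxx t0 mul0r.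
by move=> /eqP; rewrite oner_eq0.
Qed.

Lemma indep_addr x y : indep x y -> indep x (x + y).
Proof.
move=> xy a b; rewrite scalerDr addrA -scalerDl => /xy[ab b0].
by move: ab; rewrite b0 addr0.
Qed.

Lemma exists_indep2 x y : x != 0 -> y != 0 -> exists z, indep x z /\ indep y z.
Proof.
move=> x0 y0; have [z xz] := exists_indep x0.
have [yz|nyz] := pselect (indep y z); first by exists z.
have [t zt] : exists t, z = t *: y.
  by apply: contrapT => h; apply: nyz; apply: indepP => // t e; apply: h; exists t.
have xy : indep x y.
  apply: indepP => // s e; apply: (@indep_nscale _ _ _ _ (t * s) xz).
  by rewrite zt e scalerA.
exists (x + y); split; first exact: indep_addr.
by rewrite addrC; apply: indep_addr; exact: indepC.
Qed.

End IndepExistence.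

Section ConvexIsomorphism.
Variables (R : realType) (n : nat).
Implicit Types (x y z w : 'rV[R]_n) (a b s t : R) (F G : 'rV[R]_n -> 'rV[R]_n).

Definition inconv z x y :=
  exists a b, [/\ 0 <= a, 0 <= b, a + b <= 1 & z = a *: x + b *: y].

Definition inseg z x := exists2 t, 0 <= t <= 1 & z = t *: x.

(** Triangles are considered only for independent x, y, where [planar] provides test functions;
    [cm_seg] is the degenerate case. *)
Record conv_morph F : Prop := ConvMorph {
  cm_indep : forall x y, indep x y -> indep (F x) (F y);
  cm_conv : forall x y z, indep x y -> inconv z x y -> inconv (F z) (F x) (F y);
  cm_seg : forall x z, inseg z x -> inseg (F z) (F x) }.

Record conv_iso F G : Prop := ConvIso {
  ci_FK : cancel F G;
  ci_GK : cancel G F;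
  ci_F : conv_morph F;
  ci_G : conv_morph G }.

Lemma conv_iso_sym F G : conv_iso F G -> conv_iso G F.
Proof. by case. Qed.

Lemma conv_iso0 F G : conv_iso F G -> F 0 = 0.
Proof.
move=> H; have : inseg 0 (G 0) by exists 0; rewrite ?lexx ?ler01 ?scale0r.
by move=> /(cm_seg (ci_F H))[t _]; rewrite (ci_GK H) scaler0.
Qed.

Lemma conv_iso_neq0 F G x : conv_iso F G -> x != 0 -> F x != 0.
Proof.
by move=> H; apply: contraNneq => e; rewrite -(ci_FK H x) e (conv_iso0 (conv_iso_sym H)).
Qed.

Lemma conv_iso_ray F G x t : conv_iso F G -> 0 <= t ->
  exists2 s, 0 <= s & F (t *: x) = s *: F x.
Proof.
move=> H t0; have [t1|t1] := leP t 1.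
  have [] := @cm_seg _ (ci_F H) x (t *: x); first by exists t; rewrite ?t0.
  by move=> s /andP[s0 _] e; exists s.
have tn : t != 0 by rewrite gt_eqF // (lt_trans ltr01).
have [] := @cm_seg _ (ci_F H) (t *: x) x.
  exists t^-1; last by rewrite scalerA mulVf // scale1r.
  by rewrite invr_ge0 t0 invf_le1 ?ltW // (lt_trans ltr01).
move=> s /andP[s0 _] e; have [sz|sn] := eqVneq s 0.
  have [->|x0] := eqVneq x 0; first by exists 0; rewrite // scaler0 (conv_iso0 H) scaler0.
  by have := conv_iso_neq0 H x0; rewrite e sz scale0r eqxx.
by exists s^-1; rewrite ?invr_ge0 // e scalerA mulVf // scale1r.
Qed.

Lemma indep_coord x y a b c d : indep x y ->
  a *: x + b *: y = c *: x + d *: y -> a = c /\ b = d.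
Proof.
move=> xy e; have [|ac bd] := xy (a - c) (b - d).
  rewrite !scalerBl addrACA -opprD; apply/eqP; rewrite subr_eq0; exact/eqP.
by split; apply/eqP; rewrite -subr_eq0; apply/eqP.
Qed.

(** The midpoint of x and y shows that F (x + y) is in the cone of F x and F y. If a < 1, it would
    be in a triangle 0, F x, w with w on the ray of F y. Pulled back, x + y would be in a triangle
    0, x, k y, where a coefficient 1 of x leaves no weight for y. *)
Lemma conv_iso_add_coef F G x y : conv_iso F G -> indep x y ->
  exists a b, [/\ 1 <= a, 0 < b & F (x + y) = a *: F x + b *: F y].
Proof.
move=> H xy; have Fxy := cm_indep (ci_F H) xy.
pose h := 2^-1 *: (x + y).
have : inconv h x y.
  by exists 2^-1, 2^-1; rewrite /h scalerDr; split=> //; lra.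
move=> /(cm_conv (ci_F H) xy)[a' [b' [a'0 b'0 _ Fh]]].
have [s s0] := conv_iso_ray h H (ler0n R 2).
rewrite {1}/h scalerA divff ?pnatr_eq0 // scale1r Fh scalerDr !scalerA => Fs.
pose a := s * a'; pose b := s * b'.
have a0 : 0 <= a by rewrite mulr_ge0.
have b0 : 0 < b.
  rewrite lt_def mulr_ge0 // andbT; apply/eqP => bz.
  have := cm_indep (ci_F H) (indep_addr xy); rewrite Fs -/a -/b bz scale0r addr0.
  by move=> /(@indep_nscale _ _ _ _ a); apply.
exists a, b; split=> //; rewrite leNgt; apply/negP => a1.
have c0 : 0 < 1 - a by rewrite subr_gt0.
have r0 : 0 <= (1 - a)^-1 * b by rewrite mulr_ge0 ?invr_ge0 ?(ltW c0) ?(ltW b0).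
pose w := ((1 - a)^-1 * b) *: F y.
have [k k0] := conv_iso_ray (F y) (conv_iso_sym H) r0.
rewrite -/w (ci_FK H) => Gw.
have : inconv (F (x + y)) (F x) w.
  exists a, (1 - a); split; [by [] | exact: ltW | by rewrite addrC subrK |].
  by rewrite Fs scalerA mulVKf // gt_eqF.
have Fxw : indep (F x) w.
  move=> c d; rewrite scalerA => /Fxy[-> /eqP].
  have rn : (1 - a)^-1 * b != 0 by rewrite gt_eqF // mulr_gt0 // invr_gt0.
  by rewrite mulf_eq0 (negbTE rn) orbF => /eqP.
move=> /(cm_conv (ci_G H) Fxw); rewrite !(ci_FK H) Gw => -[c [d [c0' d0 cd]]].
rewrite scalerA -{1}(scale1r x) -{1}(scale1r y) => /(indep_coord xy)[c1 dk].
have d00 : d = 0 by lra.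
by move: dk => /eqP; rewrite d00 mul0r oner_eq0.
Qed.

Lemma conv_iso_opp F G x : conv_iso F G -> exists k, F (- x) = k *: F x.
Proof.
move=> H; have [->|x0] := eqVneq x 0; first by exists 0; rewrite oppr0 (conv_iso0 H) scaler0.
apply: contrapT => h; have : indep (F x) (F (- x)).
  by apply: indepP; [exact: conv_iso_neq0 H x0 | move=> t e; apply: h; exists t].
move=> /(cm_indep (ci_G H)); rewrite !(ci_FK H) -scaleN1r => /indep_nscale; exact.
Qed.

Lemma conv_iso_add_indep F G x y : conv_iso F G -> indep x y ->
  F (x + y) = F x + F y.
Proof.
move=> H; have half u v : indep u v ->
    exists b, F (u + v) = F u + b *: F v.
  move=> uv; have [a [b [a1 b0 e]]] := conv_iso_add_coef H uv.
  (* Returning from u + v to u by adding - v multiplies the coefficient of F u by some a' >= 1. As F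
     (- v) is a multiple of F v, this gives a' a = 1, and so a = 1. *)
  have uv' : indep (u + v) (- v).
    move=> c d; rewrite scalerDr scalerN -addrA -scalerBl => /uv[-> /eqP].
    by rewrite sub0r oppr_eq0 => /eqP.
  have [a' [b' [a'1 b'0]]] := conv_iso_add_coef H uv'.
  have [k ->] := conv_iso_opp v H.
  rewrite addrK e scalerDr !scalerA -addrA -scalerDl -{1}(scale1r (F u)).
  rewrite -{1}[1 *: F u]addr0 -{1}(scale0r (F v)).
  move=> /(indep_coord (cm_indep (ci_F H) uv))[aa _].
  exists b; suff -> : a = 1 by rewrite scale1r.
  apply/eqP; rewrite eq_le a1 andbT; rewrite aa ler_peMl // (le_trans ler01) //.
move=> xy; have [b e1] := half _ _ xy; have [c e2] := half _ _ (indepC xy).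
have : c *: F x + 1 *: F y = 1 *: F x + b *: F y.
  by rewrite !scale1r -e1 addrC -e2 addrC.
by move=> /(indep_coord (cm_indep (ci_F H) xy))[_ b1]; rewrite e1 -b1 scale1r.
Qed.

Hypothesis n2 : (2 <= n)%N.

(** For collinear x and y, F (x + y + z) is expanded in two ways with z off their line. *)
Lemma conv_iso_add F G x y : conv_iso F G -> F (x + y) = F x + F y.
Proof.
move=> H; have [->|x0] := eqVneq x 0; first by rewrite (conv_iso0 H) !add0r.
have [->|y0] := eqVneq y 0; first by rewrite (conv_iso0 H) !addr0.
have [xy|nxy] := pselect (indep x y); first exact: (conv_iso_add_indep H xy).
have [t yt] : exists t, y = t *: x.
  by apply: contrapT => h; apply: nxy; apply: indepP => // t e; apply: h; exists t.
have [z xz] := exists_indep n2 x0.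
have yz : indep y z.
  move=> a b; rewrite yt scalerA => /xz[/eqP]; rewrite mulf_eq0 => /orP[/eqP//|/eqP t0].
  by move: y0; rewrite yt t0 scale0r eqxx.
have xyz : indep x (y + z).
  move=> a b; rewrite scalerDr addrA yt scalerA -scalerDl => /xz[ab b0].
  by move: ab; rewrite b0 mul0r addr0.
have e : F (x + y + z) = F x + F y + F z.
  by rewrite -addrA (conv_iso_add_indep H xyz) (conv_iso_add_indep H yz) addrA.
have e' : F (x + y + z) = F (x + y) + F z.
  have [xy0|xy0] := eqVneq (x + y) 0; first by rewrite xy0 (conv_iso0 H) !add0r.
  apply: (conv_iso_add_indep H).
  have xyE : x + y = (1 + t) *: x by rewrite yt scalerDl scale1r.
  move=> a b; rewrite xyE scalerA => /xz[/eqP]; rewrite mulf_eq0 => /orP[/eqP//|/eqP t0].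
  by move: xy0; rewrite xyE t0 scale0r eqxx.
by apply: (@addIr _ (F z)); rewrite -e' e.
Qed.

Lemma conv_iso_nat F G x k : conv_iso F G -> F (k%:R *: x) = k%:R *: F x.
Proof.
move=> H; elim: k => [|k ih]; first by rewrite !scale0r (conv_iso0 H).
by rewrite -natr1 !scalerDl !scale1r (conv_iso_add _ _ H) ih.
Qed.

(** On a ray F (s x) = c F x, and additivity shows that N s and N c compare in the same way with
    every integer k; the Archimedean property yields c = s. *)
Lemma conv_iso_scale F G x t : conv_iso F G -> F (t *: x) = t *: F x.
Proof.
move=> H.
have pos s : 0 <= s -> F (s *: x) = s *: F x.
  move=> s0; have [->|x0] := eqVneq x 0; first by rewrite scaler0 (conv_iso0 H) scaler0.
  have Fx0 := conv_iso_neq0 H x0; have [c c0 e] := conv_iso_ray x H s0.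
  have lo (k N : nat) : k%:R <= N%:R * s -> k%:R <= N%:R * c.
    move=> kN; have d0 : 0 <= N%:R * s - k%:R by rewrite subr_ge0.
    have [d d0' ed] := conv_iso_ray x H d0.
    have : N%:R *: F (s *: x) = k%:R *: F x + d *: F x.
      rewrite -(conv_iso_nat _ _ H) -(conv_iso_nat _ _ H) -ed -(conv_iso_add _ _ H).
      by rewrite -scalerDl addrC subrK scalerA.
    by rewrite e scalerA -scalerDl => /(scalerIr Fx0) ->; rewrite lerDl.
  have hi (k N : nat) : N%:R * s <= k%:R -> N%:R * c <= k%:R.
    move=> kN; have d0 : 0 <= k%:R - N%:R * s by rewrite subr_ge0.
    have [d d0' ed] := conv_iso_ray x H d0.
    have : k%:R *: F x = N%:R *: F (s *: x) + d *: F x.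
      rewrite -(conv_iso_nat _ _ H) -(conv_iso_nat _ _ H) -ed -(conv_iso_add _ _ H).
      by rewrite scalerA -scalerDl addrC subrK.
    by rewrite e scalerA -scalerDl => /(scalerIr Fx0) ->; rewrite lerDl.
  rewrite e; congr (_ *: _); apply/eqP; rewrite eq_le; apply/andP; split.
    rewrite leNgt; apply/negP => sc; pose N := Num.bound (c - s)^-1.
    have N1 : 1 < N%:R * (c - s).
      rewrite -ltr_pdivrMr ?subr_gt0 // mul1r.
      by apply: archi_boundP; rewrite invr_ge0 subr_ge0 ltW.
    have := truncn_itv (mulr_ge0 (ler0n R N) s0) => /andP[t1 t2].
    have := hi _ _ (ltW t2); rewrite -natr1; nra.
  rewrite leNgt; apply/negP => sc; pose N := Num.bound (s - c)^-1.
  have N1 : 1 < N%:R * (s - c).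
    rewrite -ltr_pdivrMr ?subr_gt0 // mul1r.
    by apply: archi_boundP; rewrite invr_ge0 subr_ge0 ltW.
  have := truncn_itv (mulr_ge0 (ler0n R N) s0) => /andP[t1 t2].
  have := lo _ _ t1; move: t2; rewrite -natr1; nra.
have [t0|t0] := leP 0 t; first exact: pos.
have := conv_iso_add (t *: x) ((- t) *: x) H.
rewrite -scalerDl subrr scale0r (conv_iso0 H) (pos (- t)) ?oppr_ge0 ?ltW //.
by move=> /esym/eqP; rewrite scaleNr subr_eq0 => /eqP.
Qed.

Lemma conv_iso_mx F G : conv_iso F G ->
  exists2 M : 'M[R]_n, M \in unitmx & forall x, G x = x *m M.
Proof.
have mx F' G' : conv_iso F' G' -> exists M : 'M[R]_n, forall x, F' x = x *m M.
  move=> H; exists (\matrix_(i, j) F' (delta_mx 0 i) 0 j) => x.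
  have sumE (I : Type) (l : seq I) (f : I -> 'rV[R]_n) :
      F' (\sum_(i <- l) f i) = \sum_(i <- l) F' (f i).
    elim: l => [|i l ih]; first by rewrite !big_nil (conv_iso0 H).
    by rewrite !big_cons (conv_iso_add _ _ H) ih.
  rewrite {1}(row_sum_delta x) sumE; apply/rowP => j; rewrite summxE !mxE.
  by apply: eq_bigr => i _; rewrite (conv_iso_scale _ _ H) !mxE.
move=> H; have [M FM] := mx _ _ H; have [N GN] := mx _ _ (conv_iso_sym H).
exists N => //.
have NM : N *m M = 1%:M.
  apply/row_matrixP => i; rewrite row_mul !rowE -GN -FM mulmx1 (ci_GK H) //.
by case/mulmx1_unit: NM.
Qed.

End ConvexIsomorphism.

(** * The two types of transforms *)

Section SegmentImages.
Variables (R : realType) (n : nat) (C : R).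
Hypotheses (C1 : 1 < C) (n2 : (2 <= n)%N).
Implicit Types (f g h k p : Cvx0 R n) (x y z w u v : 'rV[R]_n).
Implicit Types (a b c d r s t : R) (T : Cvx0 R n -> Cvx0 R n).
Implicit Types (F G : 'rV[R]_n -> 'rV[R]_n).

Definition seg_to_seg T :=
  forall x, x != 0 -> exists2 u, u != 0 & T (seg x) = seg u.
Definition seg_to_lin T :=
  forall x, x != 0 -> exists2 u, u != 0 & T (seg x) = lin u 1.

Lemma epi_lin1 x : epi (lin x 1) x 1.
Proof. by have := @epi_lin _ _ x 1 1 ler01; rewrite mulr1 scale1r; apply. Qed.

Lemma cle_seg2 x z : cle (seg x) (seg z) <-> inseg z x.
Proof. by rewrite cle_seg segP; split=> [[]|]. Qed.

Lemma inseg_anti x y : inseg x y -> inseg y x -> x = y.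
Proof.
move=> [t /andP[t0 t1] ex] [s /andP[s0 s1] ey].
have [x0|x0] := eqVneq x 0; first by rewrite ey x0 scaler0.
have : (t * s) *: x = 1 *: x by rewrite scale1r -scalerA -ey -ex.
move=> /(scalerIr x0) ts1; suff t1' : t = 1 by rewrite ex t1' scale1r.
by apply/eqP; rewrite eq_le t1 -ts1 ler_piMr.
Qed.

Lemma seg_inj x y : seg x = seg y -> x = y.
Proof. by move=> e; apply: inseg_anti; apply/cle_seg2; rewrite e; exact: cle_refl. Qed.

Lemma cle_lin2 x z : cle (lin x 1) (lin z 1) <-> inseg z x.
Proof.
split=> [/cleP/(_ _ _ (epi_lin1 z))/linP[_ [t [t0]]]|[t /andP[t0 t1] ->]].
  by rewrite mul1r => t1 ->; exists t; rewrite ?t0.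
apply/cleP => y r /linP[r0 [s [s0]]]; rewrite mul1r => sr ->.
apply/linP; split=> //; exists (s * t); rewrite scalerA mul1r mulr_ge0 //.
by split=> //; apply: le_trans sr; rewrite ler_piMr.
Qed.

Lemma lin_inj x y : lin x 1 = lin y 1 -> x = y.
Proof. by move=> e; apply: inseg_anti; apply/cle_lin2; rewrite e; exact: cle_refl. Qed.

Lemma lin_neq_seg x u : u != 0 -> lin x 1 <> seg u.
Proof.
move=> u0 e; have : epi (lin x 1) u 0 by rewrite e; exact: epi_seg.
move=> /linP[_ [t [t0]]]; rewrite mul1r => t0' ux.
by move: u0; rewrite ux (le_anti (introT andP (conj t0' t0))) scale0r eqxx.
Qed.

Lemma lin01 : lin 0 1 = ctop R n.
Proof.
apply: cvx_ext => x r; rewrite ctopP linP; split=> [[r0 [t [_ _ ->]]]|[r0 ->]].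
  by rewrite scaler0.
by split=> //; exists 0; rewrite mulr0 scale0r.
Qed.

(* The lower bound q of [seg u] and [lin v 1] is pulled back to a function which
   vanishes at the midpoint m of x and y, so that q is dominated by the image of
   [seg m]; but on the rays other than those of u and v, q is neither bounded by a
   linear function nor zero anywhere but at the origin. *)
Lemma not_mixed T T' x y u v : almost_iso C T T' -> indep x y -> u != 0 -> v != 0 ->
  T (seg x) = seg u -> T (seg y) <> lin v 1.
Proof.
move=> H xy u0 v0 xu yv.
have xu' : onray u (T (seg x)) by rewrite xu; exact: seg_onray.
have yv' : onray v (T (seg y)) by rewrite yv; exact: lin_onray.
have uv := iso_indep C1 H xy u0 v0 xu' yv'.
have [q qP] := planar 0 1 1 0 uv.
have qle z : cle q (T (seg z)) <-> epi (T' q) z 0.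
  rewrite -cle_seg -{1}(iso_KT H q); split.
    by apply: (iso_exact2 C1 H); apply: Or42; exact: seg_indicator.
  by apply: (iso_exact1 C1 H); apply: Or42; exact: seg_indicator.
have qx : epi (T' q) x 0.
  apply/qle; rewrite xu; apply/cle_seg/qP; split=> //; exists 1, 0.
  by rewrite scale1r scale0r addr0; split=> //; lra.
have qy : epi (T' q) y 0.
  apply/qle; rewrite yv; apply/cleP => z r /linP[r0 [t [t0]]].
  rewrite mul1r => tr ->; apply/qP; split=> //; exists 0, t.
  by rewrite scale0r add0r; split=> //; lra.
pose m := 2^-1 *: x + 2^-1 *: y.
have : cle q (T (seg m)).
  apply/qle; have := @epi_comb _ _ (T' q) x y 0 0 2^-1 2^-1.
  by rewrite !mulr0 addr0; apply=> //; lra.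
have xm := indep_mid xy; have ym := indep_mid2 xy.
have [w w0 mw] := seg_shape C1 H (indep_neq0 (indepC xm)).
have mw' : onray w (T (seg m)).
  by case: mw => ->; [exact: seg_onray | exact: lin_onray].
have uw := iso_indep C1 H xm u0 w0 xu' mw'.
have vw := iso_indep C1 H ym v0 w0 yv' mw'.
case: mw => [->|->] /cleP qw.
  have /qP[_ [s [t [s0 t0 _]]]] := qw _ _ (epi_seg w).
  rewrite mul0r mul1r add0r => t0' ew.
  have tz : t = 0 by lra.
  by apply: (@indep_nscale _ _ _ _ s uw); rewrite ew tz scale0r addr0.
have /qP[_ [s [t [s0 t0 _ _ ew]]]] := qw _ _ (epi_lin1 w).
have sn : s != 0.
  by apply/eqP => sz; apply: (@indep_nscale _ _ _ _ t vw); rewrite ew sz scale0r add0r.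
(* At (2 / s) w the u-coordinate is 2, where q is +oo, while [lin w 1] is finite on the whole
   ray. *)
have c0 : 0 <= 2 / s by rewrite divr_ge0.
have /qP[_ [s' [t' [_ _ s'1 _]]]] : epi q ((2 / s) *: w) (2 / s).
  by apply: qw; apply/linP; split=> //; exists (2 / s); rewrite mul1r.
rewrite ew scalerDr !scalerA divfK // => /(indep_coord uv)[s'2 _].
by move: s'1; rewrite -s'2; lra.
Qed.

(** The alternative passes from x to y through a vector independent of both, since [not_mixed]
    compares independent vectors only. *)
Lemma seg_dichotomy T T' : almost_iso C T T' -> seg_to_seg T \/ seg_to_lin T.
Proof.
move=> H; have [[x [x0 [u u0 xu]]]|no] :=
    pselect (exists x, x != 0 /\ exists2 u, u != 0 & T (seg x) = seg u); last first.
  right=> x x0; have [u u0 [e|e]] := seg_shape C1 H x0; last by exists u.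
  by case: no; exists x; split=> //; exists u.
left=> y y0; have [z [xz yz]] := exists_indep2 n2 x0 y0.
have [w w0 [zw|zw]] := seg_shape C1 H (indep_neq0 (indepC xz)); last first.
  by case: (not_mixed H xz u0 w0 xu zw).
have [v v0 [yv|yv]] := seg_shape C1 H y0; first by exists v.
by case: (not_mixed H (indepC yz) w0 v0 zw yv).
Qed.

Lemma seg_to_seg_sym T T' : almost_iso C T T' -> seg_to_seg T -> seg_to_seg T'.
Proof.
move=> H A; have [//|B] := seg_dichotomy (iso_sym H).
have [x x0] := exists_neq0 R n2; have [u u0 xu] := A _ x0; have [v v0] := B _ u0.
by rewrite -xu (iso_TK H) => e; case: (lin_neq_seg x0 (esym e)).
Qed.

Lemma seg_to_lin_sym T T' : almost_iso C T T' -> seg_to_lin T -> seg_to_lin T'.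
Proof.
move=> H B; have [A|//] := seg_dichotomy (iso_sym H).
move=> x x0; have [u u0 xu] := seg_to_seg_sym (iso_sym H) A x0.
by have [v v0] := B _ x0; rewrite xu => e; case: (lin_neq_seg u0 (esym e)).
Qed.

(** A triangle is the zero set of its indicator, and zeros are preserved exactly both ways; the
    preimage of the indicator vanishes at x and y, hence on their triangle. *)
Lemma seg_to_seg_morph T T' F : almost_iso C T T' ->
  (forall x, T (seg x) = seg (F x)) -> conv_morph F.
Proof.
move=> H TF.
have F0 x : x != 0 -> F x != 0.
  move=> x0; apply/eqP => Fx0; apply: (iso_neq_ctop C1 H (seg_neq_ctop x0)).
  by rewrite TF Fx0.
have on x : onray (F x) (T (seg x)) by rewrite TF; exact: seg_onray.
have ind x y : indep x y -> indep (F x) (F y).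
  move=> xy; have x0 := F0 _ (indep_neq0 xy); have y0 := F0 _ (indep_neq0 (indepC xy)).
  exact: (iso_indep C1 H xy x0 y0).
split=> //.
- move=> x y z /ind Fxy [a [b [a0 b0 ab ->]]].
  have [g gP] := planar 0 0 1 1 Fxy.
  have gle w : epi g (F w) 0 <-> epi (T' g) w 0.
    rewrite -!cle_seg -TF -{1}(iso_KT H g); split.
      by apply: (iso_exact2 C1 H); apply: Or42; exact: seg_indicator.
    by apply: (iso_exact1 C1 H); apply: Or42; exact: seg_indicator.
  have gx : epi (T' g) x 0.
    apply/gle/gP; split=> //; exists 1, 0.
    by rewrite scale1r scale0r addr0; split=> //; lra.
  have gy : epi (T' g) y 0.
    apply/gle/gP; split=> //; exists 0, 1.
    by rewrite scale1r scale0r add0r; split=> //; lra.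
  have : epi (T' g) (a *: x + b *: y) 0.
    by have := epi_comb a0 b0 ab gx gy; rewrite !mulr0 addr0.
  move=> /gle/gP[_ [s [t [s0 t0 st _ ->]]]]; exists s, t; split=> //.
  by rewrite -[s]mul1r -[t]mul1r.
- move=> x z /cle_seg2 xz; apply/cle_seg2; rewrite -!TF.
  by apply: (iso_exact1 C1 H) xz; apply: Or42; exact: seg_indicator.
Qed.

Lemma seg_to_seg_conv T T' : almost_iso C T T' -> seg_to_seg T ->
  exists F G, [/\ conv_iso F G, (forall x, T (seg x) = seg (F x)) &
    (forall x, T' (seg x) = seg (G x))].
Proof.
have ex S S' : almost_iso C S S' -> seg_to_seg S ->
    exists F, forall x, S (seg x) = seg (F x).
  move=> H A; have /choice[F FP] : forall x, exists u, S (seg x) = seg u; last by exists F.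
  move=> x; have [->|/A[u _ xu]] := eqVneq x 0; last by exists u.
  by exists 0; exact: (iso_ctop C1 H).
move=> H A; have [F FP] := ex _ _ H A.
have [G GP] := ex _ _ (iso_sym H) (seg_to_seg_sym H A).
exists F, G; split=> //; split.
- by move=> x; apply: seg_inj; rewrite -GP -FP (iso_TK H).
- by move=> x; apply: seg_inj; rewrite -FP -GP (iso_KT H).
- exact: (seg_to_seg_morph H).
- exact: (seg_to_seg_morph (iso_sym H)).
Qed.

(** Every segment on the ray of u is the image of some [lin v 1] on the ray of x, and these are
    totally ordered. So the image g is comparable to all these segments: it vanishes before every
    point where it is finite, and is thus the indicator of an interval. The whole ray is excluded,
    being the image of [lin x 0]. *)
Lemma lin_to_seg T T' x : almost_iso C T T' -> seg_to_lin T -> seg_to_lin T' ->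
  x != 0 -> exists2 u, u != 0 & T (lin x 1) = seg u.
Proof.
move=> H B B' x0; have [u u0 xu] := B _ x0; pose g := T (lin x 1).
have su : onray u (T (seg x)) by rewrite xu; exact: lin_onray.
have sn := seg_neq_ctop x0; have ln := lin_neq_ctop x0 (@ler01 R).
have gn : g <> ctop R n by apply: (iso_neq_ctop C1 H).
have gu : onray u g.
  by apply: (iso_onray_eq C1 H x0 u0 sn ln (@seg_onray _ _ x) (@lin_onray _ _ x 1) su).
have cmp s : 0 < s -> cle (seg (s *: u)) g \/ epi g (s *: u) 0.
  move=> s0; have su0 : s *: u != 0 by rewrite scaler_eq0 negb_or gt_eqF.
  have [v v0 sv] := B' _ su0.
  have vx : onray x (lin v 1).
    rewrite -sv; apply: (iso_onray_eq C1 (iso_sym H) u0 x0 _ _ su).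
    - exact: (iso_neq_ctop C1 H).
    - exact: seg_neq_ctop.
    - move=> y r /segP[_ [t /andP[t0 _] ->]].
      by exists (t * s); rewrite ?scalerA // mulr_ge0 // ltW.
    - by rewrite (iso_TK H); exact: seg_onray.
  have [k k0 vk] := vx _ _ (epi_lin1 v).
  have Tv : T (lin v 1) = seg (s *: u) by rewrite -sv (iso_KT H).
  have ind : indicator (T (lin v 1)) by rewrite Tv; exact: seg_indicator.
  have [k1|k1] := leP k 1.
    right; apply/cle_seg; rewrite -Tv; apply: (iso_exact1 C1 H); first exact: Or44.
    by apply/cle_lin2; exists k => //; rewrite k0.
  left; rewrite -Tv; apply: (iso_exact1 C1 H); first exact: Or43.
  have k_gt0 : 0 < k by exact: lt_trans k1.
  apply/cle_lin2; exists k^-1; last by rewrite vk scalerA mulVf ?scale1r // gt_eqF.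
  by rewrite invr_ge0 k0 invf_le1 // ltW.
have beyond s t r : 0 < s -> s < t -> epi g (t *: u) r -> epi g (s *: u) 0.
  move=> s0 st gt; have [/cleP/(_ _ _ gt)/segP[_ [c /andP[_ c1]]]|//] := cmp _ s0.
  rewrite scalerA => /(scalerIr u0) tc.
  by have := ler_wpM2r (ltW s0) c1; rewrite -tc mul1r leNgt st.
have [t1 t10 [r1 gt1]] := onray_epi_pos gu gn.
pose Z t := epi g (t *: u) 0.
have h0 : 0 < t1 / 2 by lra.
have Zh : Z (t1 / 2) by apply: (beyond _ t1 r1) => //; lra.
have Zd s t : 0 <= s <= t -> Z t -> Z s by exact: epi_segment.
have Zl t : 0 < t -> (forall s, 0 < s < t -> Z s) -> Z t.
  move=> t0 h; apply: epi_ray_lim => c /andP[c0 c1].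
  by rewrite scalerA; apply: h; rewrite mulr_gt0 //= gtr_pMl.
have [all|[d d0 Zle]] := down_closed_interval h0 Zh Zd Zl.
  have : g = T (lin x 0).
    rewrite (iso_lin0 C1 H x0 u0 su); apply: cle_anti; last exact: cle_onray.
    apply/cleP => y r /linP[r0 [t [t0 _ ->]]]; apply: epi_mono r0 _; exact: all.
  move=> /(can_inj (iso_TK H)) e.
  have : epi (lin x 1) (1 *: x) 0.
    by rewrite e; apply/(epi_linE _ _ _ x0); rewrite ler01 lexx mul0r.
  by move=> /(epi_linE _ _ _ x0)[_ _]; rewrite mulr1 leNgt ltr01.
exists (d *: u); first by rewrite scaler_eq0 negb_or gt_eqF.
apply: cle_anti; first by apply/cle_seg; apply/Zle; rewrite ?lexx // ltW.
apply/cleP => y r /[dup] gy /gu[t t0 ey]; apply/segP; split; first exact: epi_ge0 gy.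
subst y; exists (t / d); last by rewrite scalerA divfK // gt_eqF.
rewrite divr_ge0 ?(ltW d0) //= ler_pdivrMr // mul1r leNgt; apply/negP => dt.
have m0 : 0 < (d + t) / 2 by lra.
have : Z ((d + t) / 2) by apply: (beyond _ t r) => //; lra.
by move=> /Zle-/(_ (ltW m0)); lra.
Qed.

(** The triangle is encoded by s + t on the cone of F x and F y: this function is below [lin w 1]
    exactly when w is in the triangle. *)
Lemma seg_to_lin_morph T T' F : almost_iso C T T' ->
  (forall x, T (seg x) = lin (F x) 1) -> conv_morph F.
Proof.
move=> H TF.
have F0 x : x != 0 -> F x != 0.
  move=> x0; apply/eqP => Fx0; apply: (iso_neq_ctop C1 H (seg_neq_ctop x0)).
  by rewrite TF Fx0 lin01.
have on x : onray (F x) (T (seg x)) by rewrite TF; exact: lin_onray.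
have ind x y : indep x y -> indep (F x) (F y).
  move=> xy; have x0 := F0 _ (indep_neq0 xy); have y0 := F0 _ (indep_neq0 (indepC xy)).
  exact: (iso_indep C1 H xy x0 y0).
split=> //.
- move=> x y z /ind Fxy [a [b [a0 b0 ab ->]]].
  have [g gP] := planar 1 1 0 0 Fxy.
  have gle w : cle g (lin (F w) 1) <-> epi (T' g) w 0.
    rewrite -!cle_seg -TF -{1}(iso_KT H g); split.
      by apply: (iso_exact2 C1 H); apply: Or42; exact: seg_indicator.
    by apply: (iso_exact1 C1 H); apply: Or42; exact: seg_indicator.
  have gx : epi (T' g) x 0.
    apply/gle/cleP => q r /linP[r0 [t [t0 tr ->]]]; apply/gP; split=> //.
    by exists t, 0; rewrite scale0r addr0; split=> //; lra.
  have gy : epi (T' g) y 0.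
    apply/gle/cleP => q r /linP[r0 [t [t0 tr ->]]]; apply/gP; split=> //.
    by exists 0, t; rewrite scale0r add0r; split=> //; lra.
  have : epi (T' g) (a *: x + b *: y) 0.
    by have := epi_comb a0 b0 ab gx gy; rewrite !mulr0 addr0.
  move=> /gle/cleP/(_ _ _ (epi_lin1 _))/gP[_ [s [t [s0 t0 _ st ->]]]].
  by exists s, t; split=> //; rewrite -[s]mul1r -[t]mul1r.
- move=> x z /cle_seg2 xz; apply/cle_lin2; rewrite -!TF.
  by apply: (iso_exact1 C1 H) xz; apply: Or42; exact: seg_indicator.
Qed.

(** The preimage of the indicator of a triangle is below [lin x 1] and [lin y 1], hence by convexity
    below [lin z 1]. *)
Lemma lin_to_seg_morph T T' F : almost_iso C T T' ->
  (forall x, T (lin x 1) = seg (F x)) -> conv_morph F.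
Proof.
move=> H TF.
have lin_ctop x : x != 0 -> lin x 1 <> ctop R n by move=> x0; exact: lin_neq_ctop.
have F0 x : x != 0 -> F x != 0.
  move=> x0; apply/eqP => Fx0; apply: (iso_neq_ctop C1 H (lin_ctop _ x0)).
  by rewrite TF Fx0.
have indTF x : indicator (T (lin x 1)) by rewrite TF; exact: seg_indicator.
have on x : x != 0 -> onray (F x) (T (seg x)).
  move=> x0; apply: (iso_onray_eq C1 H x0 (F0 _ x0) (lin_ctop _ x0) (seg_neq_ctop x0)).
  - exact: lin_onray.
  - exact: seg_onray.
  - by rewrite TF; exact: seg_onray.
have ind x y : indep x y -> indep (F x) (F y).
  move=> xy; have x0 := indep_neq0 xy; have y0 := indep_neq0 (indepC xy).
  by apply: (iso_indep C1 H xy (F0 _ x0) (F0 _ y0)); exact: on.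
split=> //.
- move=> x y z /ind Fxy [a [b [a0 b0 ab ez]]].
  have [g gP] := planar 0 0 1 1 Fxy.
  have gle w : epi g (F w) 0 <-> cle (T' g) (lin w 1).
    rewrite -!cle_seg -TF -{1}(iso_KT H g); split.
      by apply: (iso_exact2 C1 H); exact: Or44.
    by apply: (iso_exact1 C1 H); exact: Or44.
  have /gle/cleP gx : epi g (F x) 0.
    apply/gP; split=> //; exists 1, 0.
    by rewrite scale1r scale0r addr0; split=> //; lra.
  have /gle/cleP gy : epi g (F y) 0.
    apply/gP; split=> //; exists 0, 1.
    by rewrite scale1r scale0r add0r; split=> //; lra.
  have : cle (T' g) (lin z 1).
    apply/cleP => q r /linP[r0 [t [t0]]]; rewrite mul1r => tr ->.
    have lt w : epi (lin w 1) (t *: w) t by apply/linP; split=> //; exists t; rewrite mul1r.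
    have := epi_comb a0 b0 ab (gx _ _ (lt x)) (gy _ _ (lt y)).
    rewrite ez scalerDr !scalerA !(mulrC t); apply: epi_mono.
    by rewrite -mulrDl; apply: le_trans tr; rewrite ler_piMl.
  move=> /gle/gP[_ [s [t [s0 t0 st _ ->]]]]; exists s, t; split=> //.
  by rewrite -[s]mul1r -[t]mul1r.
- move=> x z /cle_lin2 xz; apply/cle_seg2; rewrite -!TF.
  by apply: (iso_exact1 C1 H) xz; exact: Or44.
Qed.

Lemma seg_to_lin_conv T T' : almost_iso C T T' -> seg_to_lin T ->
  exists F G, [/\ conv_iso F G, (forall x, T (seg x) = lin (F x) 1) &
    (forall x, T' (lin x 1) = seg (G x))].
Proof.
move=> H B; have B' := seg_to_lin_sym H B.
have /choice[F FP] : forall x, exists u, T (seg x) = lin u 1.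
  move=> x; have [->|/B[u _ xu]] := eqVneq x 0; last by exists u.
  by exists 0; rewrite lin01; exact: (iso_ctop C1 H).
have /choice[G GP] : forall x, exists u, T' (lin x 1) = seg u.
  move=> x; have [->|x0] := eqVneq x 0.
    by exists 0; rewrite lin01; exact: (iso_ctop C1 (iso_sym H)).
  by have [u _ xu] := lin_to_seg (iso_sym H) B' B x0; exists u.
exists F, G; split=> //; split.
- by move=> x; apply: seg_inj; rewrite -GP -FP (iso_TK H).
- by move=> x; apply: lin_inj; rewrite -FP -GP (iso_KT H).
- exact: (seg_to_lin_morph H).
- exact: (lin_to_seg_morph (iso_sym H)).
Qed.

End SegmentImages.

(** * Estimates *)

Section SegmentsToSegments.
Variables (R : realType) (n : nat) (C : R).
Hypotheses (C1 : 1 < C) (n2 : (2 <= n)%N).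
Variables (T T' : Cvx0 R n -> Cvx0 R n) (F G : 'rV[R]_n -> 'rV[R]_n).
Hypotheses (H : almost_iso C T T') (FG : conv_iso F G).
Hypothesis TF : forall x, T (seg x) = seg (F x).
Implicit Types (f h : Cvx0 R n) (x y z w u v : 'rV[R]_n).
Implicit Types (a b c d r s t : R).

Let C0 : 0 < C. Proof. exact: lt_trans ltr01 C1. Qed.
Let FZ x t : F (t *: x) = t *: F x. Proof. exact: (conv_iso_scale n2 _ _ FG). Qed.
Let FD x y : F (x + y) = F x + F y. Proof. exact: (conv_iso_add n2 _ _ FG). Qed.

Lemma zero_image f x : epi f x 0 <-> epi (T f) (F x) 0.
Proof.
rewrite -!cle_seg -TF; split.
  by apply: (iso_exact1 C1 H); apply: Or42; exact: seg_indicator.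
by apply: (iso_exact2 C1 H); apply: Or42; exact: seg_indicator.
Qed.

Lemma tri_image_dom x c y r : epi (T (tri x c)) y r ->
  exists2 t, 0 <= t <= 1 & y = t *: F x.
Proof.
have : cle (seg (F x)) (T (tri x c)).
  rewrite -TF; apply: (iso_exact1 C1 H); first by apply: Or41; exact: seg_indicator.
  apply/cleP => z s /triP[s0 [t [t0 t1 _ ->]]]; apply/segP; split=> //.
  by exists t => //; rewrite t0.
by move=> /cleP h /h/segP[].
Qed.

(** Otherwise the image would be above [seg (t F x)], hence [tri x c] above [seg (t x)], although it
    is finite at x. *)
Lemma tri_image_finite x c t : x != 0 -> 0 < c -> 0 < t < 1 ->
  exists r, epi (T (tri x c)) (t *: F x) r.
Proof.
move=> x0 c0 /andP[t0 t1]; apply: contrapT => no.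
have : cle (seg (t *: x)) (tri x c).
  apply: (iso_exact2 C1 H); first by apply: Or41; exact: seg_indicator.
  rewrite TF FZ; apply/cleP => y r /[dup] fy /tri_image_dom[s /andP[s0 s1] ey].
  apply/segP; split; first exact: epi_ge0 fy.
  exists (s / t); last by rewrite scalerA divfK // gt_eqF.
  rewrite divr_ge0 ?(ltW t0) //= ler_pdivrMr // mul1r leNgt; apply/negP => ts.
  apply: no; exists r; apply: epi_segment (_ : 0 <= t <= s) _; last by rewrite -ey.
  by rewrite !ltW.
have xc : epi (tri x c) (1 *: x) c.
  by apply/epi_triE => //; rewrite mulr1 ler01 lexx ltW.
move=> /cleP/(_ _ _ xc)/segP[_ [s /andP[s0 s1]]]; rewrite scalerA => /(scalerIr x0).
by move=> /esym e; have := ler_wpM2r (ltW t0) s1; rewrite e mul1r leNgt t1.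
Qed.

Let C3 c := C * (C * (C * c)).

(** The image is almost linear, by the same decomposition as for indicators: one of the two pieces
    has a preimage at most C^2 c at x, and a further C places this piece below the image of
    [tri x (C3 c)]. The truncated piece is excluded, as that image is finite up to F x. *)
Lemma tri_image_slope x c s t a : x != 0 -> 0 < c -> 0 < s < t -> t < 1 ->
  (forall b, epi (T (tri x c)) (s *: F x) b <-> a <= b) ->
  cle (lin (s *: F x) a) (T (tri x (C3 c))).
Proof.
move=> x0 c0 st t1 ha; have Fx0 := conv_iso_neq0 FG x0.
have on : onray (F x) (T (tri x c)).
  by move=> y r /tri_image_dom[b /andP[b0 _] ->]; exists b.
have cut := chord_truncation Fx0 st on ha.
have up h : epi (T' h) x (C * (C * c)) -> cle h (T (tri x (C3 c))).
  move=> hx; rewrite -[h](iso_KT H).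
  apply: (iso_scale C1 H) => y r /triP[r0 [b [b0 b1 br ->]]].
  have b01 : 0 <= b <= 1 by rewrite b0.
  apply: epi_mono (epi_scale b01 hx); rewrite ler_pdivlMr //.
  by apply: le_trans br; have -> : b * (C * (C * c)) * C = C3 c * b by rewrite /C3; ring.
have xtri : cle (seg x) (tri x c).
  apply/cleP => y r /triP[r0 [b [b0 b1 _ ->]]]; apply/segP; split=> //.
  by exists b => //; rewrite b0.
have xc : epi (tri x c) x c by apply/cle_tri; [exact: ltW | exact: cle_refl].
have [/up h1|/up h2] := image_inf C1 H x0 xtri (ltW c0) (cle_maxl _ _) (cle_maxl _ _) cut xc.
  have c30 : 0 < C3 c by rewrite !mulr_gt0.
  have m01 : 0 < (t + 1) / 2 < 1 by lra.
  have [r fr] := tri_image_finite x0 c30 m01.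
  move/cleP: h1 => /(_ _ _ fr)/cvx_maxP[_].
  move=> /segP[_ [b /andP[b0 b1]]]; rewrite scalerA => /(scalerIr Fx0) e.
  have : b * t <= 1 * t by rewrite ler_wpM2r //; lra.
  by rewrite -e; lra.
by apply: cle_trans h2; exact: cle_maxr.
Qed.

Lemma tri_image x c : x != 0 -> 0 < c -> exists g, [/\ 0 < g,
  cle (T (tri x c)) (tri (F x) g) & cle (tri (F x) g) (T (tri x (C3 c)))].
Proof.
move=> x0 c0; have Fx0 := conv_iso_neq0 FG x0.
have c30 : 0 < C3 c by rewrite !mulr_gt0.
(* By semicontinuity the image still exceeds b at some s F x with s < 1, where [tri_image_slope]
   applies. *)
have low b : 0 <= b -> ~ epi (T (tri x c)) (F x) b ->
    cle (tri (F x) b) (T (tri x (C3 c))).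
  move=> b0 /epi_near_ray[s /andP[s0 s1] /(_ s)]; rewrite lexx (ltW s1) => /(_ isT) nb.
  have s01 : 0 < s < 1 by rewrite s0.
  have [r fr] := tri_image_finite x0 c0 s01.
  have [a a0 ha] := epi_value fr.
  have ba : b <= a by rewrite leNgt; apply/negP => /ltW /ha.
  have sm : 0 < s < (s + 1) / 2 by rewrite s0; lra.
  have m1 : (s + 1) / 2 < 1 by lra.
  have /cleP sl := tri_image_slope x0 c0 sm m1 ha.
  apply/cleP => y v /[dup] fy /tri_image_dom[d /andP[d0 d1] ey].
  have v0 := epi_ge0 fy; rewrite ey; apply/triP; split=> //; exists d; split=> //.
  have /linP[_ [e [e0 av]]] := sl _ _ fy.
  rewrite ey scalerA => /(scalerIr Fx0) de; rewrite de.
  apply: le_trans av; apply: (@le_trans _ _ (b * e)).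
    by rewrite mulrA ler_piMr ?(ltW s1) // mulr_ge0.
  by rewrite ler_wpM2r.
have h01 : 0 < (2^-1 : R) < 1 by lra.
have [r0 fr0] := tri_image_finite x0 c30 h01.
have [g g0 hg] : exists2 g, 0 <= g & forall b, epi (T (tri x c)) (F x) b <-> g <= b.
  apply: (@epi_value _ _ _ _ (2 * r0 + 1)); apply: contrapT => nf.
  have r00 := epi_ge0 fr0; have b0 : 0 <= 2 * r0 + 1 by lra.
  have /cleP/(_ _ _ fr0)/(epi_triE _ _ _ Fx0)[_ _ _] := low _ b0 nf.
  lra.
have gp : 0 < g.
  rewrite lt_def g0 andbT; apply/eqP => gz.
  have : epi (T (tri x c)) (F x) 0 by apply/hg; rewrite gz.
  move=> /(zero_image _ _).2 x00; have : epi (tri x c) (1 *: x) 0 by rewrite scale1r.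
  move=> /(epi_triE _ _ _ x0)[_ _ _].
  by rewrite mulr1 leNgt c0.
exists g; split=> //; first by apply/cle_tri => //; apply/hg.
apply/cleP => y v /[dup] fy /tri_image_dom[d /andP[d0 d1] ey].
have v0 := epi_ge0 fy; rewrite ey; apply/triP; split=> //; exists d; split=> //.
rewrite leNgt; apply/negP => vg.
have dp : 0 < d.
  by rewrite lt_def d0 andbT; apply: contraTneq vg => ->; rewrite mulr0 -leNgt.
pose b := (v / d + g) / 2.
have vd : v / d < g by rewrite ltr_pdivrMr.
have vd0 : 0 <= v / d by rewrite divr_ge0.
have b0 : 0 <= b by rewrite /b; lra.
have bg : ~ epi (T (tri x c)) (F x) b by move=> /hg; rewrite /b; lra.
have /cleP/(_ _ _ fy) := low _ b0 bg; rewrite ey => /(epi_triE _ _ _ Fx0)[_ _ _].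
by rewrite -ler_pdivlMr //; rewrite /b; lra.
Qed.

(** g x c stands for the value at F x of the image of [tri x c]. In the last clause C^3 comes from
    [tri_image] and one more C from inverting [T]. *)
Lemma values_image : exists g : 'rV[R]_n -> R -> R, forall x c, x != 0 -> 0 < c ->
  [/\ 0 < g x c,
   forall f, epi f x c -> epi (T f) (F x) (C * g x c),
   forall f, epi f x c -> epi (T f) (F x) (g x (C * c)) &
   forall f, epi (T f) (F x) (g x c) -> epi f x (C ^+ 4 * c)].
Proof.
pose P (e : 'rV[R]_n * R) g := e.1 != 0 -> 0 < e.2 -> [/\ 0 < g,
  cle (T (tri e.1 e.2)) (tri (F e.1) g) & cle (tri (F e.1) g) (T (tri e.1 (C3 e.2)))].
have /choice[g gP] : forall e, exists g, P e g.
  move=> [x c]; have [x0|x0] := eqVneq x 0; first by exists 0; rewrite /P /= x0 eqxx.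
  have [c0|c0] := ltP 0 c; last by exists 0; rewrite /P /= ltNge c0.
  by have [g gP] := tri_image x0 c0; exists g.
exists (fun x c => g (x, c)) => x c x0 c0; have Cc0 : 0 < C * c by rewrite mulr_gt0.
have [g0 g1 g2] := gP (x, c) x0 c0; have [h0 h1 _] := gP (x, C * c) x0 Cc0.
rewrite /= in g0 g1 g2 h0 h1; split=> // f.
- move=> /cle_tri-/(_ (ltW c0)) fx; apply: (iso_le C1 H fx).
  by apply/cle_tri => //; exact: ltW.
- move=> fx; apply/cle_tri; first exact: ltW.
  apply: cle_trans h1; apply: (iso_scale C1 H) => y r /triP[r0 [b [b0 b1 br ->]]].
  have b01 : 0 <= b <= 1 by rewrite b0.
  apply: epi_mono (epi_scale b01 fx); rewrite ler_pdivlMr //.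
  by apply: le_trans br; have -> : b * c * C = C * c * b by ring.
- move=> /cle_tri-/(_ (ltW g0)) fx.
  have xc : epi (tri x (C3 c)) x (C3 c).
    by apply/cle_tri; [rewrite ltW // !mulr_gt0 | exact: cle_refl].
  have := iso_le' C1 H (cle_trans fx g2) xc.
  by rewrite /C3 !exprS expr0 mulr1 !mulrA.
Qed.

Section Slopes.
Variable g : 'rV[R]_n -> R -> R.
Hypothesis gP : forall x c, x != 0 -> 0 < c ->
  [/\ 0 < g x c,
   forall f, epi f x c -> epi (T f) (F x) (C * g x c),
   forall f, epi f x c -> epi (T f) (F x) (g x (C * c)) &
   forall f, epi (T f) (F x) (g x c) -> epi f x (C ^+ 4 * c)].

Lemma indep_third x z t : t < 1 -> indep x z ->
  exists2 y, indep x y & z = t *: x + (1 - t) *: y.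
Proof.
move=> t1 xz; have t0 : 1 - t != 0 by rewrite subr_eq0 gt_eqF.
exists ((1 - t)^-1 *: (z - t *: x)); last first.
  by rewrite scalerA mulfV // scale1r addrC subrK.
move=> a b; rewrite scalerA scalerBr addrCA scalerA -scalerBl addrC => /xz[ab /eqP].
rewrite mulf_eq0 invr_eq0 (negbTE t0) orbF => /eqP b0.
by move: ab; rewrite b0 mul0r mul0r subr0.
Qed.

(** Tested on f = (c / C) s on the triangle of x and y, where z = t x + (1 - t) y. C^6 is C^4 for
    the return by T', C for the slope c / C, and one more C to make the contradiction strict. *)
Lemma slope_upper x z t c : indep x z -> 0 < t < 1 -> 0 < c ->
  g z (t * c / C ^+ 6) <= t * g x c.
Proof.
move=> xz /andP[t0 t1] c0; have [y xy ez] := indep_third t1 xz.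
have x0 := indep_neq0 xz; have z0 := indep_neq0 (indepC xz).
have cC : 0 < c / C by rewrite divr_gt0.
have [f fP] := planar (c / C) 0 1 1 xy.
have fx : epi f x (c / C).
  apply/fP; split; first exact: ltW.
  by exists 1, 0; split; [lra|lra|lra|lra|rewrite scale1r scale0r addr0].
have fy : epi f y 0.
  apply/fP; split=> //.
  by exists 0, 1; split; [lra|lra|lra|lra|rewrite scale1r scale0r add0r].
have Tfx : epi (T f) (F x) (g x c).
  by have [_ _ /(_ _ fx)] := gP x0 cC; rewrite mulrCA mulfV ?mulr1 // gt_eqF.
have Tfz : epi (T f) (F z) (t * g x c).
  rewrite ez FD !FZ; have t01 : 0 <= t <= 1 by rewrite !ltW.
  by have := epi_conv t01 Tfx ((zero_image f y).1 fy); rewrite mulr0 addr0.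
have e0 : 0 < t * c / C ^+ 6 by rewrite divr_gt0 ?mulr_gt0 // exprn_gt0.
rewrite leNgt; apply/negP => lt; have [_ _ _ /(_ f)] := gP z0 e0.
move=> /(_ (epi_mono (ltW lt) Tfz)) /fP[_ [s [s' [s0 s'0 _]]]].
rewrite mul0r addr0 ez => h /(indep_coord xy)[ts _]; move: h; rewrite -ts.
have -> : C ^+ 4 * (t * c / C ^+ 6) = (c / C * t) / C by field; rewrite gt_eqF.
rewrite ler_pdivlMr // -{2}[c / C * t]mulr1 ler_pM2l ?mulr_gt0 //.
  by rewrite leNgt C1.
by rewrite invr_gt0.
Qed.

(** The mirror argument: the test function is linear on the image triangle and is pulled back by
    T'. *)
Lemma slope_lower x z t c : indep x z -> 0 < t < 1 -> 0 < c ->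
  t * g x c <= g z (C ^+ 5 * (t * c)).
Proof.
move=> xz /andP[t0 t1] c0; have [y xy ez] := indep_third t1 xz.
have x0 := indep_neq0 xz; have z0 := indep_neq0 (indepC xz).
have Fxy := cm_indep (ci_F FG) xy.
have [gx0 _ _ gx] := gP x0 c0.
have [f fP] := planar (g x c) 0 1 1 Fxy.
have fx : epi f (F x) (g x c).
  apply/fP; split; first exact: ltW.
  by exists 1, 0; split; [lra|lra|lra|lra|rewrite scale1r scale0r addr0].
have fy : epi f (F y) 0.
  apply/fP; split=> //.
  by exists 0, 1; split; [lra|lra|lra|lra|rewrite scale1r scale0r add0r].
have Tf : T (T' f) = f by rewrite (iso_KT H).
have px : epi (T' f) x (C ^+ 4 * c) by apply: gx; rewrite Tf.
have py : epi (T' f) y 0 by apply/zero_image; rewrite Tf.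
have t01 : 0 <= t <= 1 by rewrite !ltW.
have pz : epi (T' f) z (t * (C ^+ 4 * c)).
  by have := epi_conv t01 px py; rewrite mulr0 addr0 -ez.
have e0 : 0 < t * (C ^+ 4 * c) by rewrite !mulr_gt0 // exprn_gt0.
have [_ _ /(_ _ pz) + _] := gP z0 e0.
rewrite Tf ez FD !FZ => /fP[_ [s [s' [s0 s'0 _]]]].
rewrite mul0r addr0 => h /(indep_coord Fxy)[ts _]; move: h; rewrite -ts mulrC.
by have -> : C * (t * (C ^+ 4 * c)) = C ^+ 5 * (t * c) by ring.
Qed.

Lemma slope_compare x y c d : x != 0 -> y != 0 -> 0 < c -> 0 < d ->
  g x c / c <= C ^+ 11 * (g y d / d).
Proof.
move=> x0 y0 c0 d0; have [z [xz yz]] := exists_indep2 n2 x0 y0.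
have C6 : 0 < C ^+ 6 by rewrite exprn_gt0.
have C61 : 1 <= C ^+ 6 by rewrite exprn_ege1 // ltW.
have C5 : 0 < C ^+ 5 by rewrite exprn_gt0.
have C51 : 1 <= C ^+ 5 by rewrite exprn_ege1 // ltW.
pose m := Num.min c d; have m0 : 0 < m by rewrite lt_min c0.
(* Small enough for the ratios t used in both slope lemmas to be below 1. *)
pose e := m / (2 * C ^+ 6).
have e0 : 0 < e by rewrite divr_gt0 // mulr_gt0.
have em : C ^+ 6 * e = m / 2 by rewrite /e; field; rewrite gt_eqF.
have ee : e <= m / 2 by rewrite -em ler_peMl // ltW.
have mc : m <= c by rewrite ge_min lexx.
have md : m <= d by rewrite ge_min lexx orbT.
have up : g z e / e <= C ^+ 6 * (g y d / d).
  have t01 : 0 < C ^+ 6 * e / d < 1.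
    apply/andP; split; first exact: divr_gt0 (mulr_gt0 C6 e0) d0.
    by rewrite ltr_pdivrMr // em; lra.
  have := slope_upper yz t01 d0.
  have -> : C ^+ 6 * e / d * d / C ^+ 6 = e by field; rewrite !gt_eqF.
  rewrite ler_pdivrMr //.
  by have -> : C ^+ 6 * e / d * g y d = C ^+ 6 * (g y d / d) * e by ring.
have lo : g x c / c <= C ^+ 5 * (g z e / e).
  have t01 : 0 < e / (C ^+ 5 * c) < 1.
    apply/andP; split; first exact: divr_gt0 e0 (mulr_gt0 C5 c0).
    rewrite ltr_pdivrMr ?mulr_gt0 // mul1r.
    have : c <= C ^+ 5 * c by rewrite ler_peMl // ltW.
    lra.
  have := slope_lower xz t01 c0.
  have -> : C ^+ 5 * (e / (C ^+ 5 * c) * c) = e by field; rewrite !gt_eqF.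
  have -> : e / (C ^+ 5 * c) * g x c = (g x c / c) * (e / C ^+ 5) by field; rewrite !gt_eqF.
  have eC : 0 < e / C ^+ 5 by exact: divr_gt0 e0 C5.
  rewrite -(ler_pdivlMr _ _ eC) => /le_trans; apply.
  by have -> : g z e / (e / C ^+ 5) = C ^+ 5 * (g z e / e) by field; rewrite !gt_eqF.
apply: (le_trans lo); have -> : C ^+ 11 = C ^+ 5 * C ^+ 6 by rewrite -exprD.
by rewrite -mulrA ler_pM2l.
Qed.

End Slopes.

(** l is the value of g at one reference point. Passing to it costs C^11; going forward costs one
    more C, going back C^4, which makes C^15. *)
Lemma seg_to_seg_estimate : exists2 l, 0 < l & forall f x s, 0 < s ->
  (epi f x s -> epi (T f) (F x) (C ^+ 15 * (l * s))) /\
  (epi (T f) (F x) s -> epi f x (C ^+ 15 * (l^-1 * s))).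
Proof.
have [g gP] := values_image.
have [x1 x10] := exists_neq0 R n2.
pose l := g x1 1; have [l0 _ _ _] := gP _ _ x10 ltr01; rewrite -/l in l0.
have Cn (k : nat) : 0 < C ^+ k by rewrite exprn_gt0.
exists l => // f x s s0.
have [->|x0] := eqVneq x 0.
  rewrite (conv_iso0 FG); split=> _; apply: epi0; rewrite ltW //;
    by rewrite !mulr_gt0 ?invr_gt0.
have [gx0 up _ _] := gP _ _ x0 s0; split=> [/up|].
  apply: epi_mono; have := slope_compare gP x0 x10 s0 ltr01.
  rewrite -/l divr1 ler_pdivrMr // => h.
  have : C * g x s <= C * (C ^+ 11 * l * s) by rewrite ler_pM2l.
  move=> /le_trans; apply.
  have -> : C * (C ^+ 11 * l * s) = C ^+ 12 * (l * s) by ring.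
  by rewrite ler_pM2r ?mulr_gt0 // ler_weXn2l // ltW.
move=> Tfx; pose c := C ^+ 11 * (l^-1 * s).
have c0 : 0 < c by rewrite !mulr_gt0 ?invr_gt0.
have [_ _ _ down] := gP _ _ x0 c0.
have := slope_compare gP x10 x0 ltr01 c0; rewrite -/l divr1 => h.
have sg : s <= g x c.
  have -> : s = l * (l^-1 * s) by rewrite mulVKf // gt_eqF.
  have ls : 0 < l^-1 * s by rewrite mulr_gt0 ?invr_gt0.
  have : l * (l^-1 * s) <= C ^+ 11 * (g x c / c) * (l^-1 * s) by rewrite ler_pM2r.
  have -> : C ^+ 11 * (g x c / c) * (l^-1 * s) = g x c / c * c by rewrite /c; ring.
  by rewrite divfK ?gt_eqF.
have := down _ (epi_mono sg Tfx).
by have -> : C ^+ 4 * c = C ^+ 15 * (l^-1 * s) by rewrite /c; ring.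
Qed.

End SegmentsToSegments.

(** * The case of the gauge transform *)

Section SegmentsToLinear.
Variables (R : realType) (n : nat) (C : R).
Hypotheses (C1 : 1 < C) (n2 : (2 <= n)%N).
Variables (T T' : Cvx0 R n -> Cvx0 R n).
Implicit Types (f h : Cvx0 R n) (x y z w u v : 'rV[R]_n).
Implicit Types (a b c d r s t m : R) (F G P Q : 'rV[R]_n -> 'rV[R]_n).

Let C0 : 0 < C. Proof. exact: lt_trans ltr01 C1. Qed.

(** Linear maps that agree in every direction are proportional: on independent x, y the factors
    agree because x + y has a factor too. *)
Lemma conv_iso_homothetic F G P Q : conv_iso F G -> conv_iso P Q ->
  (forall x, x != 0 -> exists2 m, 0 <= m & P x = m *: F x) ->
  exists2 m, 0 < m & forall x, P x = m *: F x.
Proof.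
move=> FG PQ hm; have [x x0] := exists_neq0 R n2.
have [m m0 Px] := hm _ x0; exists m.
  rewrite lt_def m0 andbT; apply: contraTneq (conv_iso_neq0 PQ x0).
  by move=> mz; rewrite Px mz scale0r eqxx.
move=> y; have [xy|nxy] := pselect (indep x y).
  have [k _ Py] := hm _ (indep_neq0 (indepC xy)).
  have [l _ Pxy] := hm _ (indep_neq0 (indepC (indep_addr xy))).
  move: Pxy; rewrite (conv_iso_add n2 _ _ PQ) (conv_iso_add n2 _ _ FG) Px Py scalerDr.
  by move=> /(indep_coord (cm_indep (ci_F FG) xy))[-> ->].
have [t ->] : exists t, y = t *: x.
  by apply: contrapT => h; apply: nxy; apply: indepP => // t e; apply: h; exists t.
rewrite (conv_iso_scale n2 _ _ PQ) (conv_iso_scale n2 _ _ FG) Px.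
by rewrite !scalerA mulrC.
Qed.

Lemma cle_seg_tri x c : cle (seg x) (tri x c).
Proof.
apply/cleP => y r /triP[r0 [t [t0 t1 _ ->]]]; apply/segP; split=> //.
by exists t => //; rewrite t0.
Qed.

Lemma cle_lin_tri x c : 0 < c -> cle (lin (c^-1 *: x) 1) (tri x c).
Proof.
move=> c0; apply/cleP => y r /triP[r0 [t [t0 t1 ctr ->]]]; apply/linP; split=> //.
exists (c * t); rewrite mul1r scalerA mulrAC divff ?gt_eqF // mul1r.
by split=> //; rewrite mulr_ge0 // ltW.
Qed.

Lemma tri_cle v d h : v != 0 -> cle (seg (d *: v)) h -> cle (lin v 1) h ->
  cle (tri (d *: v) d) h.
Proof.
move=> v0 /cleP h1 /cleP h2; apply/cleP => y r hy.
have /segP[r0 [t /andP[t0 t1] ey]] := h1 _ _ hy.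
apply/triP; split=> //; exists t; split=> //.
have /linP[_ [s [_]]] := h2 _ _ hy; rewrite mul1r ey scalerA => sr /(scalerIr v0).
by rewrite mulrC => ->.
Qed.

(** [tri x c] is the maximum of [seg x] and [lin (c^-1 x) 1], whose images are known exactly and lie
    below its own; their maximum is again a [tri], with segment and line exchanged. Doing this for
    T' and for T gives the two implications. *)
Lemma seg_to_lin_estimate F G : almost_iso C T T' -> conv_iso F G ->
  (forall x, T (seg x) = lin (F x) 1) -> (forall x, T' (lin x 1) = seg (G x)) ->
  exists P Q m, [/\ conv_iso P Q, 0 < m & forall f z s, 0 < s ->
    (epi f ((m / s) *: Q z) (m / s) -> epi (T f) z (C * s)) /\
    (epi (T f) z s -> epi f ((m / (C * s)) *: Q z) (m / (C * s)))].
Proof.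
move=> H FG TF TG.
have B : seg_to_lin T.
  by move=> x x0; exists (F x); rewrite ?TF //; exact: conv_iso_neq0 FG x0.
have [Q [P [QP TQ TP]]] := seg_to_lin_conv C1 n2 (iso_sym H) (seg_to_lin_sym C1 n2 H B).
have PQ := conv_iso_sym QP.
have [|m m0 mP] := conv_iso_homothetic FG PQ.
  move=> x x0; have Fx0 := conv_iso_neq0 FG x0.
  have on : onray (F x) (T (seg x)) by rewrite TF; exact: lin_onray.
  have : onray (F x) (T (lin x 1)).
    apply: (iso_onray_eq C1 H x0 Fx0 _ _ _ _ on).
    - exact: seg_neq_ctop.
    - exact: lin_neq_ctop.
    - exact: seg_onray.
    - exact: lin_onray.
  by rewrite TP => /(_ _ _ (epi_seg _))[k k0 ->]; exists k.
have mG u : G u = m *: Q u.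
  apply: (can_inj (ci_FK PQ)); rewrite mP (ci_GK FG) (conv_iso_scale n2 _ _ PQ).
  by rewrite (ci_GK PQ).
exists P, Q, m; split=> // f z s s0.
have [->|z0] := eqVneq z 0.
  rewrite (conv_iso0 QP) !scaler0; split=> _; apply: epi0.
    by rewrite mulr_ge0 // ltW.
  by rewrite divr_ge0 ?mulr_ge0 // ltW.
have Qz0 := conv_iso_neq0 QP z0.
split=> [fz|Tfz].
  have md : 0 <= m / s by rewrite divr_ge0 // ltW.
  suff : cle f (T' (tri z s)).
    move=> /(iso_le C1 H); apply; rewrite (iso_KT H).
    by apply/cle_tri; [exact: ltW | exact: cle_refl].
  have /cle_trans := (cle_tri _ _ md).2 fz; apply; apply: tri_cle => //.
    have -> : seg ((m / s) *: Q z) = T' (lin (s^-1 *: z) 1).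
      by rewrite TG mG (conv_iso_scale n2 _ _ QP) scalerA.
    apply: (iso_exact1 C1 (iso_sym H)); last exact: cle_lin_tri.
    by apply: Or43; rewrite TG; exact: seg_indicator.
  rewrite -TQ; apply: (iso_exact1 C1 (iso_sym H)); last exact: cle_seg_tri.
  by apply: Or41; exact: seg_indicator.
pose c := m / (C * s); have c0 : 0 < c by rewrite divr_gt0 // mulr_gt0.
rewrite -/c; apply/cle_tri; first exact: ltW.
apply: (iso_scale' C1 H) => y r Ty.
have /cleP/(_ _ _ Ty)/segP[r0 [t t01 ey]] : cle (seg z) (T (tri (c *: Q z) c)).
  have -> : seg z = T (lin (c^-1 *: (c *: Q z)) 1).
    by rewrite scalerA mulVf ?gt_eqF // scale1r TP (ci_GK PQ).
  apply: (iso_exact1 C1 H); last exact: cle_lin_tri.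
  by apply: Or43; rewrite TP; exact: seg_indicator.
have /cleP/(_ _ _ Ty)/linP[_ [t' [_]]] : cle (lin (F (c *: Q z)) 1) (T (tri (c *: Q z) c)).
  rewrite -TF; apply: (iso_exact1 C1 H); last exact: cle_seg_tri.
  by apply: Or41; exact: seg_indicator.
have -> : F (c *: Q z) = (C * s)^-1 *: z.
  apply: (scalerI (lt0r_neq0 m0)); rewrite -mP (conv_iso_scale n2 _ _ PQ) (ci_GK PQ).
  by rewrite scalerA.
rewrite mul1r ey scalerA => t'r /(scalerIr z0) tt'.
apply: epi_mono (epi_scale t01 Tfz).
have Cs0 : 0 < C * s by rewrite mulr_gt0.
rewrite ler_pdivlMr // tt'; apply: le_trans t'r.
by have -> : t' / (C * s) * s * C = t' by field; rewrite !gt_eqF.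
Qed.

End SegmentsToLinear.

(** Only levels s > 0 are tested, since [gauge_epi] describes the gauge transform at these alone; a
    value 0 is reached by approximation. *)
Lemma lee_scale_of_epi (R : realType) (a b : \bar R) (k : R) : (0 <= a)%E -> 0 < k ->
  (forall s : R, 0 < s -> (a <= s%:E)%E -> (b <= (k * s)%:E)%E) -> (b <= k%:E * a)%E.
Proof.
move=> a0 k0 h; case: a a0 h => [r||] //; last first.
  by move=> _ _; rewrite gt0_muley ?lte_fin // leey.
rewrite lee_fin => r0 h; apply/lee_addgt0Pr => e e0.
have ek : 0 < e / k by rewrite divr_gt0.
have := h (r + e / k); rewrite lee_fin lerDl (ltW ek) ltr_wpDl // => /(_ isT isT).
by rewrite mulrDr mulrCA divff ?mulr1 // gt_eqF.
Qed.

Local Open Scope ereal_scope.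

(** [lambda] depends on [T]: multiplication by any positive number is an order isomorphism, so the
    scale cannot be absorbed into c and C, nor in the first alternative into [B], which the images
    of indicators determine. *)
Theorem theorem1p6 (R : realType) (Ct : R) (Ct_gt1 : (1 < Ct)%R) :
  exists c C : R, [/\ (0 < c)%R, (0 < C)%R &
    forall (n : nat) (T Tinv : Cvx0 R n -> Cvx0 R n),
      (2 <= n)%N -> cancel T Tinv -> cancel Tinv T ->
      almost_order_preserving Ct T -> almost_order_preserving Ct Tinv ->
      exists (B : 'M[R]_n) (lambda : R), [/\ B \in unitmx, (0 < lambda)%R &
        (forall (f : Cvx0 R n) (x : 'rV[R]_n),
           (c * lambda)%:E * val f (x *m B) <= val (T f) x
           /\ val (T f) x <= (C * lambda)%:E * val f (x *m B))
        \/
        (forall (f : Cvx0 R n) (x : 'rV[R]_n),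
           (c * lambda)%:E * gauge_transform (val f) (x *m B) <= val (T f) x
           /\ val (T f) x <=
              (C * lambda)%:E * gauge_transform (val f) (x *m B))]].
Proof.
have C0 : (0 < Ct)%R by exact: lt_trans ltr01 Ct_gt1.
have K0 : (0 < Ct ^+ 15)%R by rewrite exprn_gt0.
(* The gauge case loses only a factor Ct, absorbed into the constant of the other case. *)
have CK : (Ct <= Ct ^+ 15)%R by rewrite -{1}(expr1 Ct) ler_weXn2l // ltW.
exists (Ct ^+ 15)^-1%R, (Ct ^+ 15)%R; split; rewrite ?invr_gt0 // => n T T' n2 TK KT hT hT'.
have H : almost_iso Ct T T' by split.
have two_sided (l : R) (a b : \bar R) : (0 < l)%R -> 0 <= a -> 0 <= b ->
    (forall s : R, (0 < s)%R -> a <= s%:E -> b <= (Ct ^+ 15 * (l * s))%:E) ->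
    (forall s : R, (0 < s)%R -> b <= s%:E -> a <= (Ct ^+ 15 * (l^-1 * s))%:E) ->
    ((Ct ^+ 15)^-1 * l)%:E * a <= b /\ b <= (Ct ^+ 15 * l)%:E * a.
  move=> l0 a0 b0 ab ba; split; last first.
    by apply: lee_scale_of_epi => [//||s s0 /ab]; rewrite ?mulr_gt0 // -mulrA; apply.
  have -> : ((Ct ^+ 15)^-1 * l = (Ct ^+ 15 * l^-1)^-1)%R by rewrite [RHS]invfM invrK.
  rewrite lee_pdivrMl ?mulr_gt0 ?invr_gt0 //.
  apply: lee_scale_of_epi => [//||s s0 /ba]; first by rewrite mulr_gt0 ?invr_gt0.
  by rewrite -mulrA; apply.
have [A|B] := seg_dichotomy Ct_gt1 n2 H.
  have [F [G [FG TF _]]] := seg_to_seg_conv Ct_gt1 n2 H A.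
  have [l l0 est] := seg_to_seg_estimate Ct_gt1 n2 H FG TF.
  have [M Mu GM] := conv_iso_mx n2 FG.
  (* The matrix is that of G: the estimate at G x concerns T f at F (G x) = x. *)
  exists M, l; split=> //; left=> f x; rewrite -GM.
  by apply: two_sided => // [||s s0|s s0]; rewrite ?cvx_ge0 //;
     have [] := est f (G x) s s0; rewrite (ci_GK FG).
have [F [G [FG TF TG]]] := seg_to_lin_conv Ct_gt1 n2 H B.
have [P [Q [m [PQ m0 est]]]] := seg_to_lin_estimate Ct_gt1 n2 H FG TF TG.
have [M Mu QM] := conv_iso_mx n2 PQ.
exists M, m; split=> //; right=> f x; rewrite -QM.
apply: two_sided => // [|| s s0|s s0]; [exact: gauge_ge0 | exact: cvx_ge0 | |].
  (* The level m s turns m / (m s) into the 1 / s of [gauge_epi]. *)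
  move=> /(gauge_epi _ _ s0) fx; have ms : (0 < m * s)%R by rewrite mulr_gt0.
  have e : (m / (m * s) = s^-1)%R by field; rewrite !gt_eqF.
  have [+ _] := est f x _ ms; rewrite e => /(_ fx).
  by apply: epi_mono; rewrite ler_wpM2r // ltW.
move=> Tfx; have Km : (0 < Ct * (m^-1 * s))%R by rewrite !mulr_gt0 ?invr_gt0.
have : gauge_transform (val f) (Q x) <= (Ct * (m^-1 * s))%:E.
  apply/gauge_epi => //; have [_ /(_ Tfx)] := est f x _ s0.
  by have -> : ((Ct * (m^-1 * s))^-1 = m / (Ct * s))%R by field; rewrite !gt_eqF.
move=> /le_trans; apply; rewrite lee_fin ler_wpM2r //.
by rewrite ltW // mulr_gt0 ?invr_gt0.
Qed.
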